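(* Let $p\in(1,\infty)\setminus\{2\}$, let $\theta\in\mathbb{R}\setminus\mathbb{Q}$, and let $A^p_\theta:=C(\mathbb{T})\rtimes^p_{r_\theta}\mathbb{Z}$ be the associated $L^p$-irrational rotation algebra, where $r_\theta$ is the rotation homeomorphism of $\mathbb{T}$ by angle $2\pi\theta$. Then there is no unital contractive homomorphism from $A^p_\theta$ into a (unital) spatial AF $L^p$-operator algebra.
   Context: An $L^p$-operator algebra is a Banach algebra admitting an isometric homomorphism into $\mathcal{B}(L^p(\mu))$ for some measure space with measure $\mu$. The algebra $A^p_\theta$ is the reduced $L^p$-operator algebra of the transformation groupoid $\mathbb{Z}\ltimes_{r_\theta}\mathbb{T}$. Concretely, it is the closed subalgebra of $\mathcal{B}(\ell^p(\mathbb{Z}\times\mathbb{T}))$ (with $\mathbb{Z}\times\mathbb{T}$ discrete) generated by the operators $(f\xi)(n,x)=f(e^{2\pi i n\theta}x)\,\xi(n,x)$ for $f\in C(\mathbb{T})$, and the shift $(u\xi)(n,x)=\xi(n-1,x)$ together with its inverse. For $n\in\mathbb{N}$, $M^p_n:=\mathcal{B}(\ell^p(\{1,\dots,n\}))$. A spatial AF $L^p$-operator algebra is an $L^p$-operator algebra isometrically isomorphic to a direct limit $\varinjlim(A_j,\iota_j)_{j\in\mathbb{N}_0}$ of $L^p$-operator algebras in which each $A_j$ is isometrically isomorphic to a (finite) direct sum (with the maximum norm) of algebras of the form $M^p_n$, and each connecting homomorphism $\iota_j\colon A_j\to A_{j+1}$ is isometric. *)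

(* Defs.v *)
(* The complex field is [R[i]] for [R : realType]; it carries its topology as
   [R[i]^o]. *)
From HB Require Import structures.
From mathcomp Require Import all_boot all_order all_algebra.
From mathcomp Require Import all_classical all_reals all_analysis.
From mathcomp Require Import complex.

Set Implicit Arguments.
Unset Strict Implicit.
Unset Printing Implicit Defensive.

Import Order.TTheory GRing.Theory Num.Theory.
Import numFieldNormedType.Exports.

Local Open Scope classical_set_scope.
Local Open Scope complex_scope.
Local Open Scope ring_scope.

Lemma powRD_convex (R : realType) (p s t a b : R) : 1 <= p ->
  0 < s -> 0 < t -> s + t = 1 -> 0 <= a -> 0 <= b ->
  (a + b) `^ p <= s * s^-1 `^ p * a `^ p + t * t^-1 `^ p * b `^ p.
Proof.
move=> p1 s0 t0 st a0 b0.
have s1 : s <= 1 by rewrite -st lerDl ltW.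
have xs : a / s \in (`[0, +oo[%classic : set R).
  by rewrite inE /= in_itv/= andbT divr_ge0// ltW.
have yt : b / t \in (`[0, +oo[%classic : set R).
  by rewrite inE /= in_itv/= andbT divr_ge0// ltW.
have : (s * (a / s) + (1 - s) * (b / t)) `^ p <=
       s * (a / s) `^ p + (1 - s) * (b / t) `^ p.
  exact: (convex_powR p1 (Itv01 (ltW s0) s1) xs yt).
rewrite (_ : 1 - s = t); last by rewrite -st addrC addKr.
rewrite [s * (a / s)]mulrC divfK ?gt_eqF// [t * (b / t)]mulrC divfK ?gt_eqF//.
rewrite !powRM ?invr_ge0 ?(ltW s0, ltW t0)//.
by rewrite [a `^ p * _]mulrC [b `^ p * _]mulrC !mulrA.
Qed.

Lemma esum_mulr_le (R : realType) (I : choiceType) (c : R) (a : I -> R) :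
  0 <= c -> (forall i, 0 <= a i) ->
  (\esum_(i in [set: I]) (c * a i)%:E <=
     c%:E * \esum_(i in [set: I]) (a i)%:E)%E.
Proof.
move=> c0 a0; apply: ge_ereal_sup => _ [X [finX XI] <-].
under eq_fsbigr do rewrite EFinM.
rewrite -ge0_mule_fsumr; last by move=> i; rewrite lee_fin.
by rewrite lee_wpmul2l ?lee_fin//; apply: ereal_sup_ubound; exists X.
Qed.

Section lp_space.
Variables (R : realType) (p : R) (I : choiceType).
Implicit Types f g : I -> R[i].

(* [lp_sum f] is the p-th power of the l^p norm. *)
Definition lp_sum f : \bar R :=
  \esum_(i in [set: I]) (Normc.normc (f i) `^ p)%:E.

Lemma lp_sum_ge0 f : (0 <= lp_sum f)%E.
Proof. by apply: esum_ge0 => i _; rewrite lee_fin powR_ge0. Qed.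

Lemma lp_sum0 : p != 0 -> lp_sum 0 = 0%E.
Proof. by move=> p0; apply: esum1 => i _; rewrite Normc.normc0 powR0. Qed.

Hypothesis p1 : 1 <= p.
Let p_gt0 : 0 < p. Proof. exact: lt_le_trans p1. Qed.
Let p_neq0 : p != 0. Proof. by rewrite gt_eqF. Qed.

(* The dependency on [p1] lets the submodule structure below be inferred. *)
Definition lp_pred of 1 <= p : {pred I -> R[i]} :=
  fun f => (lp_sum f < +oo)%E.

Lemma normc_ge0 (z : R[i]) : 0 <= Normc.normc z.
Proof. by case: z => a b; exact: sqrtr_ge0. Qed.

Lemma lp_sumD f g (s t : R) : 0 < s -> 0 < t -> s + t = 1 ->
  (lp_sum (f + g)%R <= (s * s^-1 `^ p)%:E * lp_sum f +
                     (t * t^-1 `^ p)%:E * lp_sum g)%E.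
Proof.
move=> s0 t0 st.
have cs : 0 <= s * s^-1 `^ p by rewrite mulr_ge0 ?powR_ge0 ?ltW.
have ct : 0 <= t * t^-1 `^ p by rewrite mulr_ge0 ?powR_ge0 ?ltW.
apply: (@le_trans _ _ (\esum_(i in [set: I])
   ((s * s^-1 `^ p * Normc.normc (f i) `^ p)%:E +
   (t * t^-1 `^ p * Normc.normc (g i) `^ p)%:E))%E).
  apply: le_esum => i _; rewrite -EFinD lee_fin.
  apply: le_trans; last first.
    by apply: (powRD_convex p1 s0 t0 st); exact: normc_ge0.
  apply: ge0_ler_powR; rewrite ?nnegrE ?addr_ge0 ?normc_ge0 ?(ltW p_gt0)//.
  exact: (le_normcD (f i) (g i)).
rewrite esumD; first last.
- by move=> i _; rewrite lee_fin mulr_ge0// powR_ge0.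
- by move=> i _; rewrite lee_fin mulr_ge0// powR_ge0.
by apply: leeD; apply: esum_mulr_le => // i; exact: powR_ge0.
Qed.

Lemma lp_sumZ_le (c : R[i]) f :
  (lp_sum (c *: f)%R <= (Normc.normc c `^ p)%:E * lp_sum f)%E.
Proof.
apply: le_trans; last first.
  by apply: esum_mulr_le => [|i]; exact: powR_ge0.
by apply: le_esum => i _; rewrite Normc.normcM powRM// normc_ge0.
Qed.

Lemma lp_submod_closed : submod_closed (lp_pred p1).
Proof.
split=> [|c f g]; first by rewrite unfold_in lp_sum0.
rewrite !unfold_in => flty glty.
have half0 : 0 < 2^-1 :> R by rewrite invr_gt0.
apply: le_lt_trans (lp_sumD _ _ half0 half0 _) _.
  by rewrite [RHS]splitr div1r.
apply: lte_add_pinfty; rewrite lte_mul_pinfty ?lee_fin ?mulr_ge0 ?powR_ge0//.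
apply: le_lt_trans (lp_sumZ_le _ _) _.
by rewrite lte_mul_pinfty ?lee_fin ?powR_ge0.
Qed.

End lp_space.


Lemma real_complex_leD (R : rcfType) (x y z : R) :
  x <= y + z -> x%:C <= y%:C + z%:C.
Proof. by move=> xyz; rewrite -rmorphD lecR. Qed.

Lemma real_complex_normM (R : rcfType) (c : R[i]) (x : R) :
  (Normc.normc c * x)%:C = `|c| * x%:C.
Proof. by rewrite rmorphM; case: c. Qed.

Section lp_type.
Variables (R : realType) (p : R) (p1 : 1 <= p) (I : choiceType).

HB.instance Definition _ :=
  GRing.isSubmodClosed.Build R[i] (I -> R[i]) (lp_pred p1)
    (@lp_submod_closed R p I p1).

(* The Banach space l^p(I), for a discrete index set I. *)
Record lp := Lp { lp_fun :> I -> R[i] ; lp_funP : lp_fun \in lp_pred p1 }.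

HB.instance Definition _ := [isSub for lp_fun].
HB.instance Definition _ := [Choice of lp by <:].
HB.instance Definition _ := [SubChoice_isSubLmodule of lp by <:].

Implicit Types f g : lp.

Definition lp_norm f : R := fine (lp_sum p f) `^ p^-1.

Let p_gt0 : 0 < p. Proof. exact: lt_le_trans p1. Qed.
Let p_neq0 : p != 0. Proof. by rewrite gt_eqF. Qed.

Lemma lp_norm_ge0 f : 0 <= lp_norm f.
Proof. exact: powR_ge0. Qed.

Lemma lp_normE f : lp_sum p f = (lp_norm f `^ p)%:E.
Proof.
rewrite /lp_norm -powRrM mulVf// powRr1 ?fine_ge0 ?lp_sum_ge0//.
rewrite fineK// ge0_fin_numE ?lp_sum_ge0//.
by have := lp_funP f; rewrite unfold_in.
Qed.

Lemma lp_norm_le f (c : R) : 0 <= c ->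
  (lp_sum p f <= (c `^ p)%:E)%E -> lp_norm f <= c.
Proof.
move=> c0; rewrite lp_normE lee_fin => fc.
rewrite leNgt; apply/negP => cf.
suff : c `^ p < lp_norm f `^ p by rewrite ltNge fc.
by apply: gt0_ltr_powR => //; rewrite nnegrE ?lp_norm_ge0.
Qed.

Lemma lp_norm_eq0 f : lp_norm f = 0 -> f = 0.
Proof.
move=> f0; apply: val_inj; apply/funext => i /=.
have : ((Normc.normc (f i) `^ p)%:E <= 0 :> \bar R)%E.
  have <- : lp_sum p f = 0%E by rewrite lp_normE f0 powR0.
  apply: esum_ge; exists [set i]; first by split => //; exact: finite_set1.
  by rewrite fsbig_set1.
rewrite lee_fin le_eqVlt ltNge powR_ge0 orbF => /eqP/powR_eq0_eq0.
exact: Normc.eq0_normc.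
Qed.

Lemma lp_norm0 : lp_norm 0 = 0.
Proof. by rewrite /lp_norm lp_sum0//= powR0// invr_eq0. Qed.

Lemma lp_normD f g : lp_norm (f + g) <= lp_norm f + lp_norm g.
Proof.
have [->|f0] := eqVneq f 0; first by rewrite add0r lp_norm0 add0r.
have [->|g0] := eqVneq g 0; first by rewrite addr0 lp_norm0 addr0.
have a0 : 0 < lp_norm f.
  by rewrite lt_neqAle lp_norm_ge0 andbT eq_sym; apply: contra_neq f0 => /lp_norm_eq0.
have b0 : 0 < lp_norm g.
  by rewrite lt_neqAle lp_norm_ge0 andbT eq_sym; apply: contra_neq g0 => /lp_norm_eq0.
have fE := lp_normE f; have gE := lp_normE g.
apply: (@lp_norm_le (f + g) (lp_norm f + lp_norm g)).
  exact: addr_ge0 (lp_norm_ge0 f) (lp_norm_ge0 g).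
have ab0 : 0 < lp_norm f + lp_norm g := addr_gt0 a0 b0.
have := @lp_sumD R p I p1 f g _ _ (divr_gt0 a0 ab0) (divr_gt0 b0 ab0).
rewrite fE gE; move: (lp_norm f) (lp_norm g) a0 b0 ab0 => a b a0 b0 ab0.
rewrite -mulrDl divff ?gt_eqF// => /(_ erefl) /le_trans; apply.
rewrite -!EFinM -EFinD lee_fin !invf_div -!mulrA.
rewrite -!powRM ?divr_ge0 ?(ltW a0) ?(ltW b0) ?(ltW ab0)// !divfK ?gt_eqF//.
by rewrite !mulrA -!mulrDl divff ?gt_eqF// mul1r.
Qed.

Lemma lp_normZ_le (c : R[i]) f : lp_norm (c *: f) <= Normc.normc c * lp_norm f.
Proof.
apply: lp_norm_le; first by rewrite mulr_ge0 ?normc_ge0 ?lp_norm_ge0.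
apply: le_trans (lp_sumZ_le _ _ _) _.
by rewrite lp_normE -EFinM lee_fin powRM ?normc_ge0 ?lp_norm_ge0.
Qed.

Lemma lp_normZ (c : R[i]) f : lp_norm (c *: f) = Normc.normc c * lp_norm f.
Proof.
apply/le_anti; rewrite lp_normZ_le /=.
have [->|c0] := eqVneq c 0; first by rewrite Normc.normc0 mul0r lp_norm_ge0.
have nc0 : 0 < Normc.normc c.
  rewrite lt_neqAle normc_ge0 andbT eq_sym; apply: contra_neq c0.
  exact: Normc.eq0_normc.
rewrite -ler_pdivlMl// -Normc.normcV.
have := lp_normZ_le c^-1 (c *: f).
by rewrite scalerA mulVf ?scale1r.
Qed.

Let lp_cnorm f : R[i] := (lp_norm f)%:C.

Let lp_cnormD f g : lp_cnorm (f + g) <= lp_cnorm f + lp_cnorm g.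
Proof. exact: real_complex_leD (lp_normD f g). Qed.

Let lp_cnormZ (c : R[i]) f : lp_cnorm (c *: f) = `|c| * lp_cnorm f.
Proof. by rewrite /lp_cnorm lp_normZ real_complex_normM. Qed.

Let lp_cnorm_eq0 f : lp_cnorm f = 0 -> f = 0.
Proof. by move=> /complexI; exact: lp_norm_eq0. Qed.

HB.instance Definition _ :=
  Lmodule_isNormed.Build R[i] lp lp_cnormD lp_cnormZ lp_cnorm_eq0.

Lemma lp_normrE f : `|f| = (lp_norm f)%:C.
Proof. by []. Qed.

End lp_type.


Section operators.
Variables (R : realType) (E : normedModType R[i]).

(* The norm of a [normedModType R[i]] takes its values in [R[i]]; these values
   are nonnegative reals. *)
Definition rnorm (x : E) : R := complex.Re `|x|.

Definition bounded_operator : set (E -> E) :=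
  [set T | linear T /\ exists M : R, forall x, rnorm (T x) <= M * rnorm x].

Definition opnorm (T : E -> E) : R :=
  sup [set rnorm (T x) | x in [set x | rnorm x <= 1]].

Record closed_subalgebra (Alg : set (E -> E)) : Prop := {
  csub_bounded : Alg `<=` bounded_operator ;
  csub_linear : forall (a : R[i]) S T, Alg S -> Alg T -> Alg (a *: S + T) ;
  csub_comp : forall S T, Alg S -> Alg T -> Alg (S \o T) ;
  csub_closed : forall T, bounded_operator T ->
    (forall e : R, 0 < e -> exists2 S, Alg S & opnorm (T - S) < e) -> Alg T
}.

Definition generated_closed_subalgebra (G : set (E -> E)) : set (E -> E) :=
  smallest closed_subalgebra G.

End operators.

(* Banach algebras need not be unital. *)
HB.mixin Record CompleteNormedModule_isBanachAlgebra (K : numFieldType) A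
    of CompleteNormedModule K A := {
  bmul : A -> A -> A ;
  bmulA : associative bmul ;
  bmulDl : left_distributive bmul +%R ;
  bmulDr : right_distributive bmul +%R ;
  bmulZl : forall (a : K) (x y : A), bmul (a *: x) y = a *: bmul x y ;
  bmulZr : forall (a : K) (x y : A), bmul x (a *: y) = a *: bmul x y ;
  ler_norm_bmul : forall x y : A, `|bmul x y| <= `|x| * `|y|
}.

#[short(type="banachAlgType")]
HB.structure Definition BanachAlgebra (K : numFieldType) :=
  {A of CompleteNormedModule K A & CompleteNormedModule_isBanachAlgebra K A}.

Section banach_algebras.
Variable R : realType.
Implicit Types A B : banachAlgType R[i].

Definition is_unit_element B (e : B) : Prop :=
  forall x : B, bmul e x = x /\ bmul x e = x.

Record algebra_hom A B (phi : A -> B) : Prop := {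
  ahom_linear : linear phi ;
  ahom_mul : forall x y, phi (bmul x y) = bmul (phi x) (phi y)
}.

Definition isometric A B (phi : A -> B) : Prop :=
  forall x, rnorm (phi x) = rnorm x.

(* Unital contractive homomorphisms from a unital algebra [Alg] of bounded
   operators, with the operator norm, to a Banach algebra with unit [e]; the
   values of [phi] outside [Alg] are irrelevant. *)
Record unital_contractive_hom (E : normedModType R[i]) (Alg : set (E -> E))
    B (e : B) (phi : (E -> E) -> B) : Prop := {
  uchom_linear : forall (a : R[i]) S T, Alg S -> Alg T ->
    phi (a *: S + T) = a *: phi S + phi T ;
  uchom_mul : forall S T, Alg S -> Alg T -> phi (S \o T) = bmul (phi S) (phi T) ;
  uchom_unit : phi idfun = e ;
  uchom_contractive : forall T, Alg T -> rnorm (phi T) <= opnorm T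
}.

End banach_algebras.

Section Lp_operator_algebras.
Variables (R : realType) (p : R).

Section representation.
Variables (d : measure_display) (T : measurableType d).
Variable mu : {measure set T -> \bar R}.
Implicit Types f g : T -> R[i].

Definition cmeasurable f : Prop :=
  measurable_fun setT (fun t => complex.Re (f t)) /\
  measurable_fun setT (fun t => complex.Im (f t)).

Definition cLnorm f : \bar R :=
  ('N[mu]_(p%:E)[EFin \o (@Normc.normc R \o f)])%E.

Definition cLp : set (T -> R[i]) :=
  [set f | cmeasurable f /\ (cLnorm f < +oo)%E].

(* An isometric homomorphism [B -> B(L^p(mu))].  Classes of functions in
   L^p(mu) are handled through representatives: [rho b] is a map on functions
   which induces a bounded linear map on the classes. *)
Record isometric_Lp_representation (B : banachAlgType R[i])
    (rho : B -> (T -> R[i]) -> (T -> R[i])) : Prop := {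
  Lprep_stable : forall b f, cLp f -> cLp (rho b f) ;
  Lprep_ae : forall b f g, cLp f -> cLp g ->
    ae_eq mu setT f g -> ae_eq mu setT (rho b f) (rho b g) ;
  Lprep_linear : forall b (a : R[i]) f g, cLp f -> cLp g ->
    ae_eq mu setT (rho b (a *: f + g)) (a *: rho b f + rho b g) ;
  Lprep_hom_linear : forall (a : R[i]) b c f, cLp f ->
    ae_eq mu setT (rho (a *: b + c) f) (a *: rho b f + rho c f) ;
  Lprep_hom_mul : forall b c f, cLp f ->
    ae_eq mu setT (rho (bmul b c) f) (rho b (rho c f)) ;
  Lprep_isometric : forall b, (rnorm b)%:E =
    ereal_sup [set cLnorm (rho b f) | f in [set f | cLp f /\ (cLnorm f <= 1)%E]]
}.

End representation.

Definition Lp_operator_algebra (B : banachAlgType R[i]) : Prop :=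
  exists (d : measure_display) (T : measurableType d)
         (mu : {measure set T -> \bar R}) rho,
    @isometric_Lp_representation d T mu B rho.

End Lp_operator_algebras.

Section spatial_AF.
Variables (R : realType) (p : R) (p1 : 1 <= p).

(* [Psi] is an isometric isomorphism of [A] onto the direct sum, with the
   maximum norm, of the algebras M^p_(n i) = B(l^p({1, ..., n i})). *)
Record matrix_sum_isomorphism (A : banachAlgType R[i]) (m : nat)
    (n : 'I_m -> nat)
    (Psi : A -> forall i : 'I_m, lp p1 'I_(n i) -> lp p1 'I_(n i)) : Prop := {
  msum_bounded : forall a i, bounded_operator (Psi a i) ;
  msum_linear : forall (c : R[i]) a b i,
    Psi (c *: a + b) i = c *: Psi a i + Psi b i ;
  msum_mul : forall a b i, Psi (bmul a b) i = Psi a i \o Psi b i ;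
  msum_surjective : forall S, (forall i, bounded_operator (S i)) ->
    exists a, forall i, Psi a i = S i ;
  msum_isometric : forall a, rnorm a = \big[Num.max/0]_(i < m) opnorm (Psi a i)
}.

(* Nonempty direct sums of nonzero matrix algebras; in particular, the zero
   algebra is excluded. *)
Definition is_matrix_sum (A : banachAlgType R[i]) : Prop :=
  exists (m : nat) (n : 'I_m -> nat) Psi,
    [/\ (0 < m)%N, forall i, (0 < n i)%N & @matrix_sum_isomorphism A m n Psi].

Section direct_limits.
Variables (A : nat -> banachAlgType R[i]) (iota : forall j, A j -> A j.+1).

(* The composite A_j -> A_(j+1) -> ... -> A_(j+k). *)
Fixpoint connecting (j k : nat) : A j -> A (k + j) :=
  match k return A j -> A (k + j) with
  | 0 => id
  | k'.+1 => fun a => iota (connecting k' a)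
  end.

(* [B] is the completion of the algebraic direct limit for the seminorm
   ||[a]|| = lim_k ||iota_(j, j+k) a||, a in A_j. *)
Record is_direct_limit (B : banachAlgType R[i]) (gamma : forall j, A j -> B) :
    Prop := {
  dlim_hom : forall j, algebra_hom (gamma j) ;
  dlim_compatible : forall j a, gamma j.+1 (iota a) = gamma j a ;
  dlim_norm : forall j a,
    (fun k => rnorm (connecting k a)) @ \oo --> rnorm (gamma j a) ;
  dlim_dense : dense (\bigcup_j range (gamma j))
}.

End direct_limits.

Definition spatial_AF_algebra (B : banachAlgType R[i]) : Prop :=
  Lp_operator_algebra p B /\
  exists (A : nat -> banachAlgType R[i]) (iota : forall j, A j -> A j.+1)
         (gamma : forall j, A j -> B),
    [/\ forall j, Lp_operator_algebra p (A j),
        forall j, is_matrix_sum (A j),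
        forall j, algebra_hom (iota j) /\ isometric (iota j) &
        is_direct_limit iota gamma].

End spatial_AF.

Section rotation_algebra.
Variables (R : realType) (p : R) (p1 : 1 <= p) (theta : R).

Definition circle : choiceType := {z : R[i] | `|z| == 1}.

Definition expi (t : R) : R[i] := cos t +i* sin t.

Local Notation E := (lp p1 (int * circle)%type).

(* An element of C(T) is given by a function on the plane whose restriction to
   the unit circle is continuous; its values elsewhere are irrelevant. *)
Definition continuous_on_circle (f : R[i]^o -> R[i]^o) : Prop :=
  {within [set z : R[i]^o | `|z| = 1], continuous f}.

Definition multiplication_operators : set (E -> E) :=
  [set T | exists2 f, continuous_on_circle f &
    forall (xi : E) n (x : circle),
      T xi (n, x) = f (expi (2 * pi * n%:~R * theta) * val x) * xi (n, x)].

(* [shift 1] contains only the bilateral shift u, [shift (-1)] its inverse. *)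
Definition shift (k : int) : set (E -> E) :=
  [set T | forall (xi : E) n (x : circle), T xi (n, x) = xi (n - k, x)].

Definition rotation_algebra : set (E -> E) :=
  generated_closed_subalgebra
    (multiplication_operators `|` shift 1 `|` shift (-1)).

End rotation_algebra.

Arguments multiplication_operators {R p} p1 theta _.
Arguments shift {R p} p1 k _.
Arguments rotation_algebra {R p} p1 theta _.

(* Main.v *)
(** The images of functions with values in [0, 1] are hermitian in the target:
    [e + (z - 1) f] is a contraction for every z of the unit circle.  When
    p <> 2, a nearly hermitian matrix acting on l^p is nearly diagonal, uniformly
    in its size.  Hence in a spatial AF algebra B the hermitian elements commute
    with the diagonal matrix units b_k of every stage.  Let v and w be the images
    of the shift and of the coordinate function, so that w v = lam v w with
    lam = exp(2 i pi theta).  The conjugates v b_l v^-1 are hermitian as well,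
    thus commute with the b_k; if v is close to the stage, each b_k is then equal
    to b_k v b_l v^-1 for some l =: s(k).  The map s has a periodic point
    k = s^N(k), for which b_k v^M = b_k v^M b_k for all multiples M of N.  As
    b_k w is close to a multiple of b_k, this forces lam^M to stay close to 1 for
    all these M, so lam^N = 1 and theta is rational. *)

Require Import Defs.
From HB Require Import structures.
From mathcomp Require Import all_boot all_order all_algebra.
From mathcomp Require Import all_classical all_reals all_analysis.
From mathcomp Require Import complex ring lra.

Import Order.TTheory GRing.Theory Num.Theory.
Import numFieldNormedType.Exports.
Local Open Scope classical_set_scope.
Local Open Scope complex_scope.
Local Open Scope ring_scope.

Set Implicit Arguments.
Unset Strict Implicit.
Unset Printing Implicit Defensive.

(** * The duality map of l^p and Young's inequality *)

Section duality_map.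
Variables (R : realType) (p : R).
Hypothesis p1 : 1 < p.
Let p_gt0 : 0 < p. Proof. exact: lt_trans p1. Qed.
Let p_neq0 : p != 0. Proof. by rewrite gt_eqF. Qed.
Implicit Types a b c z : R[i].

(* The semi-inner product of l^p: [dualz a * b] is the coordinate of the
   pairing of b with the norming functional of a. *)
Definition dualz a : R[i] := (Normc.normc a `^ (p - 2))%:C * (a^*)%C.

Lemma normc_gt0 a : (0 < Normc.normc a) = (a != 0).
Proof.
rewrite lt_neqAle normc_ge0 andbT eq_sym; congr (~~ _).
by apply/eqP/eqP => [/Normc.eq0_normc//|->]; rewrite Normc.normc0.
Qed.

Lemma normc_conj a : Normc.normc (a^*)%C = Normc.normc a.
Proof. by case: a => x y /=; rewrite sqrrN. Qed.

Lemma normc_real (x : R) : Normc.normc x%:C = `|x|.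
Proof. by rewrite /= expr0n /= addr0 sqrtr_sqr. Qed.

Lemma Re_le_normc a : `|complex.Re a| <= Normc.normc a.
Proof. by rewrite -lecR; exact: normc_ge_Re. Qed.

Lemma Im_le_normc a : `|complex.Im a| <= Normc.normc a.
Proof.
have := Re_le_normc (a * 'i).
by rewrite ReiNIm normrN Normc.normcM /= expr0n expr1n /= add0r sqrtr1 mulr1.
Qed.

Lemma dualz0 : dualz 0 = 0.
Proof. by rewrite /dualz conjc0 mulr0. Qed.

Lemma dualzM a b : dualz (a * b) = dualz a * dualz b.
Proof.
rewrite /dualz Normc.normcM powRM ?normc_ge0// !rmorphM /=.
by rewrite !mulrA; congr (_ * _); rewrite mulrAC.
Qed.

Lemma normc_dualz a : Normc.normc (dualz a) = Normc.normc a `^ (p - 1).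
Proof.
have [->|a0] := eqVneq a 0.
  by rewrite dualz0 Normc.normc0 powR0// subr_eq0 gt_eqF.
rewrite /dualz Normc.normcM normc_conj normc_real ger0_norm ?powR_ge0//.
rewrite -[X in _ * X]powRr1 ?normc_ge0// -powRD; first by congr (_ `^ _); ring.
by rewrite [Normc.normc a == 0]gt_eqF ?normc_gt0// implybT.
Qed.

Lemma dualz_self a : dualz a * a = (Normc.normc a `^ p)%:C.
Proof.
have [->|a0] := eqVneq a 0.
  by rewrite mulr0 Normc.normc0 powR0.
rewrite /dualz -mulrA [(a^*)%C * a]mulrC -sqr_normc.
have -> : `|a| = (Normc.normc a)%:C by [].
rewrite -rmorphXn -rmorphM /=; congr (_ %:C).
rewrite -powR_mulrn ?normc_ge0// -powRD; first by congr (_ `^ _); ring.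
by rewrite [Normc.normc a == 0]gt_eqF ?normc_gt0// implybT.
Qed.

(** Young's inequality for the conjugate exponents [p / (p - 1)] and [p], since [dualz a] has
    modulus |a|^(p-1). *)
Lemma Re_dualz_le a b : complex.Re (dualz a * b) <=
  (1 - p^-1) * Normc.normc a `^ p + p^-1 * Normc.normc b `^ p.
Proof.
apply: (le_trans (ler_norm _)); apply: (le_trans (Re_le_normc _)).
rewrite Normc.normcM normc_dualz.
have q0 : 0 < p / (p - 1) by rewrite divr_gt0// subr_gt0.
have pm1 : p - 1 != 0 by rewrite subr_eq0 gt_eqF.
have := @conjugate_powR R _ _ _ _ (powR_ge0 (Normc.normc a) (p - 1))
  (normc_ge0 b) q0 p_gt0.
rewrite -powRrM.
have -> : (p - 1) * (p / (p - 1)) = p by field.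
have -> : (p / (p - 1))^-1 = 1 - p^-1 by field; rewrite p_neq0 pm1.
by rewrite subrK => /(_ erefl); rewrite [_ * (1 - p^-1)]mulrC [_ / p]mulrC.
Qed.

End duality_map.

(** * Numerical range of near-hermitian maps on finite l^p *)

Section near_hermitian_pairing.
Variables (R : realType) (p : R) (I : finType).
Hypothesis p1 : 1 < p.
Let p_gt0 : 0 < p. Proof. exact: lt_trans p1. Qed.
Implicit Types x y t : I -> R[i].

Definition psum x : R := \sum_i Normc.normc (x i) `^ p.
Definition pairing x y : R[i] := \sum_i dualz p (x i) * y i.

Lemma psum_ge0 x : 0 <= psum x.
Proof. by apply: sumr_ge0 => i _; exact: powR_ge0. Qed.

Lemma pairing_self x : pairing x x = (psum x)%:C.
Proof.
by rewrite /pairing rmorph_sum; apply: eq_bigr => i _; rewrite (dualz_self p1).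
Qed.

Lemma Re_sum (J : finType) (F : J -> R[i]) :
  complex.Re (\sum_i F i) = \sum_i complex.Re (F i).
Proof. by apply: (big_morph (@complex.Re R)) => // -[a b] [c d]. Qed.

(** Young's inequality in each coordinate, with equality for y = x. It replaces Hoelder's inequality
    and keeps all estimates in terms of p-th powers of norms. *)
Lemma Re_pairing_le x y :
  complex.Re (pairing x y) <= (1 - p^-1) * psum x + p^-1 * psum y.
Proof.
rewrite Re_sum !mulr_sumr -big_split /=.
by apply: ler_sum => i _; exact: Re_dualz_le.
Qed.

Lemma pairingD x y t : pairing x (y + t) = pairing x y + pairing x t.
Proof.
by rewrite -big_split; apply: eq_bigr => i _ /=; rewrite mulrDr.
Qed.

Lemma pairingZ x c y : pairing x (c *: y) = c * pairing x y.
Proof.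
by rewrite mulr_sumr; apply: eq_bigr => i _ /=; rewrite mulrCA.
Qed.

Lemma psumN x : psum (- x) = psum x.
Proof. by apply: eq_bigr => i _; rewrite -[(- x) i]/(- x i) normcN. Qed.

(* A near-hermitian element has nearly real numerical range: test the
   functional at x against x + (z - 1) t, for z = -1 and for the points
   z = (1 + i s)^2 / (1 + s^2) of the circle, at distance about 2|s| from 1. *)
Lemma Im_pairing_le x t r : 0 < r -> r <= 1 ->
  (forall z : R[i], Normc.normc z = 1 ->
     psum (x + (z - 1) *: t) <= (1 + p * r ^+ 2) * psum x) ->
  `|complex.Im (pairing x t)| <= 3 * r * psum x.
Proof.
move=> r0 r1 H.
set P := psum x; set a := complex.Re (pairing x t).
set b := complex.Im (pairing x t).
have P0 : 0 <= P := psum_ge0 x.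
have ReE z : complex.Re (pairing x (x + (z - 1) *: t)) =
    P + ((complex.Re z - 1) * a - complex.Im z * b).
  rewrite pairingD pairingZ pairing_self -/P /a /b.
  by case: z (pairing x t) => z1 z2 [u v] /=; ring.
(* The factor [p] in the hypothesis cancels the [p^-1] of [Re_pairing_le]. *)
have bound y : psum y <= (1 + p * r ^+ 2) * P ->
    complex.Re (pairing x y) <= (1 + r ^+ 2) * P.
  move=> yP; apply: (le_trans (Re_pairing_le x y)); rewrite -/P.
  have := ler_wpM2l (ltW (etrans (invr_gt0 p) p_gt0)) yP.
  have -> : p^-1 * ((1 + p * r ^+ 2) * P) = p^-1 * P + r ^+ 2 * P.
    by field; rewrite gt_eqF.
  by move=> ?; lra.
(* For z = -1 the test vector is x - 2t; pairing x with its opposite bounds 2a - P. *)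
have a_le : a <= (1 + r ^+ 2 / 2) * P.
  have N1 : Normc.normc (-1 : R[i]) = 1 by rewrite normcN Normc.normc1.
  have := H (-1) N1; rewrite -psumN => /bound.
  have -> : pairing x (- (x + (-1 - 1) *: t)) = - pairing x (x + (-1 - 1) *: t).
    by rewrite -scaleN1r pairingZ mulN1r.
  have -> : complex.Re (- pairing x (x + (-1 - 1) *: t)) =
      - complex.Re (pairing x (x + (-1 - 1) *: t)).
    by case: (pairing x _).
  by rewrite ReE /= oppr0 mul0r => ?; lra.
have key s : s ^+ 2 = r ^+ 2 -> - s * b <= r ^+ 2 * (3 * P).
  move=> sr; have d0 : 0 < 1 + s ^+ 2 by rewrite ltr_wpDr ?sqr_ge0.
  pose z : R[i] := ((1 - s ^+ 2) / (1 + s ^+ 2)) +i* (2 * s / (1 + s ^+ 2)).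
  have z1 : Normc.normc z = 1.
    rewrite /z /= -[RHS]sqrtr1; congr Num.sqrt.
    by field; rewrite gt_eqF.
  have := bound _ (H z z1); rewrite ReE /=.
  have -> : P + (((1 - s ^+ 2) / (1 + s ^+ 2) - 1) * a
       - 2 * s / (1 + s ^+ 2) * b) =
      P + (- 2 * (s ^+ 2 * a) - 2 * (s * b)) / (1 + s ^+ 2).
    by field; rewrite gt_eqF.
  rewrite [(1 + r ^+ 2) * P]mulrDl mul1r lerD2l ler_pdivrMr // sr.
  have r2 : r ^+ 2 <= 1 by rewrite expr_le1 // ltW.
  have r20 : 0 <= r ^+ 2 by rewrite sqr_ge0.
  (* The second-order term in [a] is absorbed by [a_le]. The resulting error is quadratic in r, and
     dividing by r at the end leaves a linear one. *)
  move: (r ^+ 2) r2 r20 a_le => q q1 q0 a_le.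
  have : q * a <= q * ((1 + q / 2) * P) by rewrite ler_wpM2l.
  have : q * P * q <= q * P * 1 by rewrite ler_wpM2l // mulr_ge0.
  have : 0 <= q * P by rewrite mulr_ge0.
  by move=> ? ? ? ?; lra.
have := key r erefl; have := key (- r); rewrite sqrrN => /(_ erefl).
rewrite opprK => h1 h2.
have h3 : r * b <= r * (3 * r * P) by lra.
have h4 : r * - b <= r * (3 * r * P) by lra.
by rewrite ler_norml lerNl -(ler_pM2l r0) h4 /= -(ler_pM2l r0).
Qed.

End near_hermitian_pairing.

(** * Off-diagonal corners of near-hermitian matrices *)

Section off_diagonal_corner.
Variables (R : realType) (p : R) (I : finType).
Hypothesis p1 : 1 < p.
Let p_gt0 : 0 < p. Proof. exact: lt_trans p1. Qed.
Implicit Types x y : I -> R[i].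

Lemma dualz_disjoint (a b c : R[i]) : a = 0 \/ b = 0 ->
  dualz p (a + c * b) = dualz p a + dualz p c * dualz p b.
Proof.
by case=> ->; rewrite ?mulr0 dualz0 ?mulr0 ?add0r ?addr0 ?dualzM.
Qed.

Lemma psum_disjoint x y c : (forall i, x i = 0 \/ y i = 0) ->
  psum p (x + c *: y) = psum p x + Normc.normc c `^ p * psum p y.
Proof.
move=> xy; rewrite /psum mulr_sumr -big_split; apply: eq_bigr => i _ /=.
rewrite -[(x + c *: y) i]/(x i + c * y i).
case: (xy i) => ->; last first.
  by rewrite mulr0 Normc.normc0 powR0 ?mulr0 ?addr0 // gt_eqF.
rewrite add0r Normc.normc0 powR0 ?gt_eqF // add0r Normc.normcM.
by rewrite powRM ?normc_ge0.
Qed.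

(** The four terms scale in [c] as 1, [c], [dualz c] and |c|^p, which allows them to be separated.
    The pairing of x with [ty] is [psum p x] because [ty] agrees with x on the support of x. *)
Lemma pairing_disjoint x y tx ty c :
  (forall i, x i = 0 \/ y i = 0) -> (forall i, x i = 0 \/ x i = ty i) ->
  pairing p (x + c *: y) (tx + c *: ty) =
  pairing p x tx + c * (psum p x)%:C + dualz p c * pairing p y tx
    + (Normc.normc c `^ p)%:C * pairing p y ty.
Proof.
move=> xy xty; rewrite -(dualz_self p1) -(pairing_self p1) /pairing.
rewrite !mulr_sumr -!big_split; apply: eq_bigr => i _ /=.
rewrite -[(x + c *: y) i]/(x i + c * y i) -[(tx + c *: ty) i]/(tx i + c * ty i).
have -> : dualz p (x i) * x i = dualz p (x i) * ty i.
  by case: (xty i) => [->|-> //]; rewrite dualz0 !mul0r.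
by rewrite dualz_disjoint //; ring.
Qed.

(** For [c] = i rho, [Im_pairing_le] makes A + rho X - rho^(p-1) B + rho^p D small, where B is the
    real part of the pairing of y with [tx]; A and D are already small by themselves. Then rho = 1
    gives X close to B and rho = 2 gives 2 X close to k B, so that (2 - k) X is small. *)
Lemma off_diagonal_ineq x y tx ty r k : k = 2 `^ (p - 1) -> 0 < r -> r <= 1 ->
  (forall i, x i = 0 \/ y i = 0) -> (forall i, x i = 0 \/ x i = ty i) ->
  (forall (c z : R[i]), Normc.normc z = 1 ->
     psum p (x + c *: y + (z - 1) *: (tx + c *: ty)) <=
       (1 + p * r ^+ 2) * psum p (x + c *: y)) ->
  (forall z : R[i], Normc.normc z = 1 ->
     psum p (y + (z - 1) *: ty) <= (1 + p * r ^+ 2) * psum p y) ->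
  `|2 - k| * psum p x <= 6 * r * ((1 + k) * psum p x + 3 * k * psum p y).
Proof.
move=> kdef r0 r1 xy xty Hx Hy.
set X := psum p x; set Y := psum p y.
have k0 : 0 < k by rewrite kdef powR_gt0.
have kE : 2 `^ p = 2 * k by rewrite kdef mulr_powRB1.
have HD := Im_pairing_le p1 r0 r1 Hy.
have HA : `|complex.Im (pairing p x tx)| <= 3 * r * X.
  apply: (Im_pairing_le p1 r0 r1) => z z1.
  by have := Hx 0 z z1; rewrite !scale0r !addr0.
have HC rho : 0 < rho ->
   `|complex.Im (pairing p x tx) + rho * X
     - rho `^ (p - 1) * complex.Re (pairing p y tx)
     + rho `^ p * complex.Im (pairing p y ty)| <= 3 * r * (X + rho `^ p * Y).
  move=> rho0; pose c : R[i] := 0 +i* rho.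
  have nc : Normc.normc c = rho.
    by rewrite /c /= expr0n add0r sqrtr_sqr gtr0_norm.
  have dc : dualz p c = 0 -i* (rho `^ (p - 1)).
    have -> : rho `^ (p - 1) = rho `^ (p - 2) * rho.
      rewrite -[X in _ * X]powRr1 ?ltW // -powRD; first by congr (_ `^ _); ring.
      by rewrite (gt_eqF rho0) implybT.
    rewrite /dualz nc /c; apply/eqP; rewrite eq_complex /=.
    by apply/andP; split; apply/eqP; ring.
  have := Im_pairing_le p1 r0 r1 (Hx c).
  rewrite pairing_disjoint // psum_disjoint // nc dc -/X -/Y.
  suff -> : complex.Im (pairing p x tx + c * X%:C
      + (0 -i* rho `^ (p - 1)) * pairing p y tx
      + (rho `^ p)%:C * pairing p y ty) = complex.Im (pairing p x tx) + rho * X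
     - rho `^ (p - 1) * complex.Re (pairing p y tx)
     + rho `^ p * complex.Im (pairing p y ty) by [].
  case: (pairing p x tx) => a1 a2; case: (pairing p y tx) => b1 b2.
  by case: (pairing p y ty) => d1 d2 /=; ring.
have := HC 1 ltr01; have := HC 2 (ltr0n R 2).
rewrite !powR1 !mul1r kE -kdef; move: HA HD.
have X0 : 0 <= X by exact: psum_ge0.
have Y0 : 0 <= Y by exact: psum_ge0.
rewrite -/Y.
move: (complex.Im (pairing p x tx)) (complex.Im (pairing p y ty)) => A D.
move: (complex.Re (pairing p y tx)) => B.
rewrite !ler_norml => /andP[A1 A2] /andP[D1 D2] /andP[h1 h2] /andP[h3 h4].
have kD1 : k * D <= k * (3 * r * Y) by apply: (ler_wpM2l (ltW k0)).
have kD2 : k * - D <= k * (3 * r * Y) by apply: (ler_wpM2l (ltW k0)); lra.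
have e1 : k * (X - B) <= k * (6 * r * (X + Y)).
  by apply: (ler_wpM2l (ltW k0)); lra.
have e2 : k * (B - X) <= k * (6 * r * (X + Y)).
  by apply: (ler_wpM2l (ltW k0)); lra.
(* Split (2 - k) X as (2 X - k B) + k (B - X) and bound both terms. *)
rewrite -{1}(ger0_norm X0) -normrM ler_norml.
by apply/andP; split; lra.
Qed.

End off_diagonal_corner.

(** * The space l^p of a finite index set *)

Section finite_lp.
Variables (R : realType) (p : R) (I : finType).
Hypothesis p1 : 1 <= p.

Lemma lp_sum_fin (f : I -> R[i]) : lp_sum p f = (psum p f)%:E.
Proof.
rewrite /lp_sum esum_fset //; last by move=> i _; rewrite lee_fin powR_ge0.
rewrite fsbig_finite //= -sumEFin.
apply: perm_big; apply: uniq_perm => //; first by rewrite finmap.fset_uniq.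
  exact: index_enum_uniq.
move=> i; rewrite mem_index_enum in_fset_set ?inE //.
  by rewrite in_setT.
all: exact: finite_finset.
Qed.

Lemma lp_fin_memP (f : I -> R[i]) : f \in lp_pred p1.
Proof. by rewrite unfold_in lp_sum_fin ltry. Qed.

Definition lp_fin (f : I -> R[i]) : lp p1 I := Lp (lp_fin_memP f).

Lemma lp_norm_psum (x : lp p1 I) : lp_norm x `^ p = psum p x.
Proof. by apply: EFin_inj; rewrite -lp_normE lp_sum_fin. Qed.

End finite_lp.

(** * Near-hermitian operators are nearly diagonal *)

Section near_hermitian.
Variables (R : realType) (p : R).
Hypothesis p1 : 1 < p.
Let p_gt0 : 0 < p. Proof. exact: lt_trans p1. Qed.

(** Multiplication by a function with values in [0, 1] satisfies this with [eps] = 0. The condition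
    takes the place of the usual definition of hermitian elements by exponentials. *)
Definition near_hermitian_operator (E : normedModType R[i]) (eps : R)
    (T : E -> E) : Prop :=
  forall z : R[i], Normc.normc z = 1 ->
  forall x, rnorm (x + (z - 1) *: T x) <= (1 + eps) * rnorm x.

Lemma rnorm_lp (I : choiceType) (x : lp (ltW p1) I) : rnorm x = lp_norm x.
Proof. by []. Qed.

(* The constant |2 - 2^(p-1)| below is nonzero exactly because p <> 2. *)
Lemma off_diagonal_small (delta : R) : p != 2 -> 0 < delta ->
  exists2 eps, 0 < eps & forall (I : finType)
      (T : lp (ltW p1) I -> lp (ltW p1) I) (S : pred I) (x y : lp (ltW p1) I),
    linear T -> near_hermitian_operator eps T ->
    (forall i, S i -> y i = 0) -> (forall i, x i = if S i then T y i else 0) ->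
    rnorm x <= delta * rnorm y.
Proof.
move=> p2 d0.
have fin (r m k D X Y : R) : m * X <= 6 * r * ((1 + k) * X + 3 * k * Y) ->
    r * (12 * (1 + k)) * X <= m * X -> r * (36 * k) * Y <= m * D * Y ->
    m * X <= m * (D * Y).
  by move=> h1 h2 h3; lra.
pose k : R := 2 `^ (p - 1).
have k0 : 0 < k by rewrite powR_gt0.
have m0 : 0 < `|2 - k|.
  rewrite normr_gt0 subr_eq0; apply: contra_neq p2 => k2.
  have : ln k = ln (2 : R) by rewrite -k2.
  rewrite /k ln_powR => /(congr1 (fun t => t / ln 2)).
  have l2 : ln (2 : R) != 0 by rewrite gt_eqF // ln_gt0 // ltr1n.
  by rewrite mulfK // divff // => h; lra.
set m := `|2 - k| in m0 *.
have dp0 : 0 < delta `^ p by rewrite powR_gt0.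
(* This [r] makes the X-term of [off_diagonal_ineq] at most half of m X, and the Y-term at most half
   of m delta^p Y. *)
pose r := Num.min 1 (Num.min (m / (12 * (1 + k))) (m * delta `^ p / (36 * k))).
have k1 : 0 < 1 + k by rewrite addr_gt0.
have r0 : 0 < r by rewrite !lt_min ltr01 !divr_gt0 ?mulr_gt0.
have r1 : r <= 1 by rewrite ge_min lexx.
have rm1 : r * (12 * (1 + k)) <= m.
  by rewrite -ler_pdivlMr ?mulr_gt0 // !ge_min lexx !orbT.
have rm2 : r * (36 * k) <= m * delta `^ p.
  by rewrite -ler_pdivlMr ?mulr_gt0 // !ge_min lexx !orbT.
have c0 : 0 < 1 + p * r ^+ 2 by rewrite ltr_wpDr // mulr_ge0 ?sqr_ge0 // ltW.
(* Solves (1 + eps)^p = 1 + p r^2, the bound used in [Im_pairing_le]. It depends only on p and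
   [delta], whence the uniformity in [I] and [T]. *)
pose eps := (1 + p * r ^+ 2) `^ p^-1 - 1.
have eps0 : 0 < eps.
  have one : 1 = 1 `^ p^-1 :> R by rewrite powR1.
  rewrite subr_gt0 [X in X < _]one gt0_ltr_powR ?invr_gt0 //.
  - by rewrite nnegrE.
  - by rewrite nnegrE ltW.
  - by rewrite ltrDl mulr_gt0 // exprn_gt0.
exists eps => // I T S x y lT hT Sy xE.
have cK : (1 + eps) `^ p = 1 + p * r ^+ 2.
  rewrite /eps addrC subrK -powRrM mulVf ?gt_eqF // powRr1 // ltW //.
have H z (w : lp (ltW p1) I) : Normc.normc z = 1 ->
    psum p (w + (z - 1) *: T w) <= (1 + p * r ^+ 2) * psum p w.
  move=> z1; rewrite -(lp_norm_psum (w + _)) -(lp_norm_psum w) -cK.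
  have e1 : 0 <= 1 + eps by rewrite addr_ge0 // ltW.
  rewrite -powRM ?lp_norm_ge0 // ge0_ler_powR ?nnegrE ?lp_norm_ge0 // ?(ltW p_gt0) //.
    by rewrite mulr_ge0 ?lp_norm_ge0.
  exact: hT.
have T_lin c a b : T (a + c *: b) = T a + c *: T b.
  by rewrite addrC lT addrC.
have xy i : x i = 0 \/ y i = 0.
  by rewrite xE; case: ifP => [/Sy|]; [right|left].
have xT i : x i = 0 \/ x i = T y i by rewrite xE; case: ifP; [right|left].
have := @off_diagonal_ineq R p I p1 x y (T x) (T y) r k erefl r0 r1 xy xT.
rewrite -/m => /(_ _ (fun z => H z y)) ineq.
have /ineq : forall c z : R[i], Normc.normc z = 1 ->
    psum p ((x : I -> R[i]) + c *: (y : I -> R[i])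
      + (z - 1) *: ((T x : I -> R[i]) + c *: (T y : I -> R[i]))) <=
    (1 + p * r ^+ 2) * psum p ((x : I -> R[i]) + c *: (y : I -> R[i])).
  by move=> c z z1; have := H z (x + c *: y) z1; rewrite T_lin.
rewrite -(lp_norm_psum x) -(lp_norm_psum y) => le1.
rewrite !rnorm_lp; apply: lp_norm_le.
  by rewrite mulr_ge0 ?lp_norm_ge0 // ltW.
rewrite lp_normE lee_fin powRM ?lp_norm_ge0 ?(ltW d0) //.
have X0 := powR_ge0 (lp_norm x) p; have Y0 := powR_ge0 (lp_norm y) p.
have h1 := ler_wpM2r X0 rm1; have h2 := ler_wpM2r Y0 rm2.
by rewrite -(ler_pM2l m0); exact: (fin _ _ _ _ _ _ le1 h1 h2).
Qed.

(** The limit delta -> 0 of [off_diagonal_small]: the corners of an exactly hermitian T vanish. *)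
Lemma hermitian_off_diagonal (I : finType) (T : lp (ltW p1) I -> lp (ltW p1) I)
    (S : pred I) (y : lp (ltW p1) I) : p != 2 ->
  linear T -> near_hermitian_operator 0 T -> (forall i, S i -> y i = 0) ->
  forall i, S i -> T y i = 0.
Proof.
move=> p2 lT hT Sy i Si.
pose x : lp (ltW p1) I := lp_fin (ltW p1) (fun i => if S i then T y i else 0).
suff x0 : x = 0.
  by have := congr1 (fun u : lp (ltW p1) I => u i) x0; rewrite /= Si.
apply: lp_norm_eq0; apply/eqP; rewrite eq_le lp_norm_ge0 andbT.
apply/ler_addgt0Pl => d d0; rewrite addr0.
(* The summand 1 in the denominator covers y = 0. *)
have c0 : 0 < d / (1 + rnorm y) by rewrite divr_gt0 // ltr_wpDr ?lp_norm_ge0.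
have [eps eps0 /(_ I T S x y lT)] := off_diagonal_small p2 c0.
have he : near_hermitian_operator eps T.
  move=> z z1 w; apply: le_trans (hT z z1 w) _.
  by rewrite ler_wpM2r ?lp_norm_ge0 // lerD2l ltW.
move=> /(_ he Sy (fun=> erefl)) /le_trans; apply.
rewrite mulrAC ler_pdivrMr ?ltr_wpDr ?lp_norm_ge0 //.
by rewrite ler_wpM2l ?(ltW d0) // lerDr.
Qed.

End near_hermitian.

(** * Real-valued norms *)

Section rnorm_theory.
Variables (R : realType) (E : normedModType R[i]).
Implicit Types x y : E.

Lemma rnormE x : `|x| = (rnorm x)%:C.
Proof. by rewrite /rnorm RRe_real // ger0_real. Qed.

Lemma rnorm_ge0 x : 0 <= rnorm x.
Proof. by rewrite -ler0c -rnormE. Qed.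

Lemma rnormD x y : rnorm (x + y) <= rnorm x + rnorm y.
Proof. by rewrite -lecR rmorphD /= -!rnormE ler_normD. Qed.

Lemma rnormN x : rnorm (- x) = rnorm x.
Proof. by rewrite /rnorm normrN. Qed.

Lemma rnormB x y : rnorm (x - y) = rnorm (y - x).
Proof. by rewrite -rnormN opprB. Qed.

Lemma rnormZ (c : R[i]) x : rnorm (c *: x) = Normc.normc c * rnorm x.
Proof. by apply: complexI; rewrite -rnormE normrZ rnormE rmorphM. Qed.

Lemma rnorm0 : rnorm (0 : E) = 0.
Proof. by rewrite /rnorm normr0. Qed.

Lemma rnorm_eq0 x : rnorm x = 0 -> x = 0.
Proof. by move=> x0; apply/normr0_eq0; rewrite rnormE x0. Qed.

Lemma rnorm_contracted x (c : R) : c < 1 -> rnorm x <= c * rnorm x -> x = 0.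
Proof.
move=> c1 xc; apply: rnorm_eq0; apply/eqP.
rewrite eq_le rnorm_ge0 andbT leNgt; apply/negP => x0.
by move: xc; rewrite leNgt -[X in _ < X]mul1r ltr_pM2r // c1.
Qed.

End rnorm_theory.

Notation "x ** y" := (bmul x y) (at level 40, left associativity).

(** * Arithmetic in Banach algebras *)

Section banach_algebra_theory.
Variables (R : realType) (B : banachAlgType R[i]).
Implicit Types x y z : B.

Lemma rnorm_bmul x y : rnorm (x ** y) <= rnorm x * rnorm y.
Proof. by rewrite -lecR rmorphM /= -!rnormE ler_norm_bmul. Qed.

Lemma rnorm_bmul_le x y (c d : R) : rnorm x <= c -> rnorm y <= d ->
  rnorm (x ** y) <= c * d.
Proof.
move=> xc yd; apply: le_trans (rnorm_bmul x y) _.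
by apply: ler_pM => //; exact: rnorm_ge0.
Qed.

Lemma bmul0l x : 0 ** x = 0.
Proof. by have := bmulZl (0 : R[i]) x x; rewrite !scale0r. Qed.

Lemma bmul0r x : x ** 0 = 0.
Proof. by have := bmulZr (0 : R[i]) x x; rewrite !scale0r. Qed.

Lemma bmulNl x y : (- x) ** y = - (x ** y).
Proof. by rewrite -scaleN1r bmulZl scaleN1r. Qed.

Lemma bmulNr x y : x ** (- y) = - (x ** y).
Proof. by rewrite -scaleN1r bmulZr scaleN1r. Qed.

Lemma bmulBl x y z : (x - y) ** z = x ** z - y ** z.
Proof. by rewrite bmulDl bmulNl. Qed.

Lemma bmulBr x y z : x ** (y - z) = x ** y - x ** z.
Proof. by rewrite bmulDr bmulNr. Qed.

Lemma bmul_sumr (I : finType) (F : I -> B) x :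
  x ** (\sum_i F i) = \sum_i x ** F i.
Proof. by apply: (big_morph (bmul x)); [exact: bmulDr|exact: bmul0r]. Qed.

Lemma bmul_suml (I : finType) (F : I -> B) x :
  (\sum_i F i) ** x = \sum_i F i ** x.
Proof.
apply: (big_morph (fun y => y ** x)); last exact: bmul0l.
by move=> y z; exact: bmulDl.
Qed.

Lemma idempotent_rnorm_ge1 x : x ** x = x -> x != 0 -> 1 <= rnorm x.
Proof.
move=> xx x0; rewrite leNgt; apply: contra_neqN x0 => x1.
by apply: (rnorm_contracted x1); rewrite -{1}xx rnorm_bmul.
Qed.

End banach_algebra_theory.

(** Factor 1 - mu^(2^(m+1)) as (1 + mu^(2^m)) (1 - mu^(2^m)). The first factor has modulus at least
    2 - 2/3 = 4/3, so a nonzero distance to 1 would grow geometrically. *)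
Lemma normc_1B_powers (R : realType) (mu : R[i]) :
  (forall m, Normc.normc (1 - mu ^+ m) <= 2 / 3) -> mu = 1.
Proof.
move=> H; set t := Normc.normc (1 - mu).
have growth m : (4 / 3) ^+ m * t <= Normc.normc (1 - mu ^+ (2 ^ m)).
  elim: m => [|m IH]; first by rewrite expr0 mul1r expn0 expr1.
  rewrite expnSr exprM -[X in X - _](expr1n _ 2) subr_sqr Normc.normcM.
  rewrite exprSr mulrAC; apply: ler_pM => //.
  - by rewrite mulr_ge0 ?normc_ge0 ?exprn_ge0 ?divr_ge0.
  - have := le_normcD (1 + mu ^+ (2 ^ m)) (1 - mu ^+ (2 ^ m)).
    have -> : 1 + mu ^+ (2 ^ m) + (1 - mu ^+ (2 ^ m)) = 2%:C.
      by rewrite addrACA subrr addr0 -rmorphD.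
    by rewrite normc_real ger0_norm // => h; have := H (2 ^ m)%N; lra.
apply/eqP; rewrite eq_sym -subr_eq0; apply/negPn; rewrite -normc_gt0.
apply/negP => t0; rewrite -/t in t0.
(* Bernoulli's inequality, to make (4/3)^m [t] exceed 2/3. *)
have bern m : 1 + m%:R / 3 <= (4 / 3 : R) ^+ m.
  elim: m => [|m IH]; first by rewrite mul0r addr0 expr0.
  have m0 : 0 <= m%:R :> R by [].
  by rewrite exprSr -natr1; lra.
have [m hm] : exists m : nat, 3 / t < m%:R.
  by exists (Num.truncn (3 / t)).+1; exact: truncnS_gt.
have := growth m; have := H (2 ^ m)%N; move: hm; rewrite ltr_pdivrMr // => h1 h2 h3.
have : (1 + m%:R / 3) * t <= (4 / 3) ^+ m * t by rewrite ler_wpM2r // ltW.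
by move=> h4; lra.
Qed.

(** * The rotation relation in the presence of diagonal idempotents *)

Section rotation_relation.
Variables (R : realType) (B : banachAlgType R[i]) (e : B).
Hypothesis he : is_unit_element e.
Variables (v v' w w' : B) (lam : R[i]).
Hypotheses (v1 : rnorm v <= 1) (v'1 : rnorm v' <= 1) (w'1 : rnorm w' <= 1).
Hypotheses (vv' : v ** v' = e) (v'v : v' ** v = e) (ww' : w ** w' = e).
Hypotheses (lam1 : Normc.normc lam = 1) (wv : w ** v = lam *: (v ** w)).
Variables (K : finType) (k0 : K) (b : K -> B).
Hypotheses (b_idem : forall k, b k ** b k = b k) (b_neq0 : forall k, b k != 0).
Hypotheses (b1 : forall k, rnorm (b k) <= 1) (sum_b : \sum_k b k = e).
Variables (a a' : B).
Hypotheses (va : rnorm (v - a) <= 4^-1) (wa' : rnorm (w - a') <= 4^-1).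
(** Matrix entries of the approximants of w and v. In [a_entry], [u] and [u'] stand for the matrix
    units E_kl and E_lk, and c = 0 covers k and l in different blocks. *)
Hypothesis a'_diag : forall k, exists c : R[i], b k ** a' ** b k = c *: b k.
Hypothesis a_entry : forall k l, exists (c : R[i]) (u u' : B),
  [/\ rnorm u <= 1, rnorm u' <= 1, b k ** a ** b l = c *: u &
      u ** u' = b k \/ c = 0].
Hypothesis wb : forall k, w ** b k = b k ** w.
Hypothesis vbv'b : forall k l,
  b k ** (v ** b l ** v') = (v ** b l ** v') ** b k.

Let emul x : e ** x = x. Proof. by case: (he x). Qed.
Let mule x : x ** e = x. Proof. by case: (he x). Qed.

Let rb k : 1 <= rnorm (b k).
Proof. exact: idempotent_rnorm_ge1. Qed.

(* Since [b k] and [v b_l v^-1] commute, their product is an idempotent; it is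
   also close to a multiple of a partial isometry with range [b k]. *)
Lemma conjugate_zero_or_full k l :
  b k ** (v ** b l ** v') = 0 \/ b k ** (v ** b l ** v') = b k.
Proof.
set q := v ** b l ** v'; set g := b k ** q.
have qq : q ** q = q.
  by rewrite /q -!bmulA [v' ** (v ** _)]bmulA v'v emul [b l ** (b l ** _)]bmulA b_idem.
have gg : g ** g = g.
  by rewrite /g {2}vbv'b -/q -bmulA [q ** (q ** _)]bmulA qq -vbv'b bmulA b_idem.
have [->|g0] := eqVneq g 0; first by left.
right; have := idempotent_rnorm_ge1 gg g0.
have [c [u [u' [u1 u'1 E uu']]]] := a_entry k l.
set s := b k ** v ** b l.
have gs : g = s ** v' by rewrite /g /q /s !bmulA.
have sE : rnorm (s - c *: u) <= 4^-1.
  have -> : s - c *: u = b k ** (v - a) ** b l.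
    by rewrite -E bmulBr bmulBl.
  by rewrite -[4^-1]mulr1 -[4^-1]mul1r; do 2?apply: rnorm_bmul_le.
have s_le : rnorm g <= rnorm s.
  by rewrite gs -[leRHS]mulr1; apply: rnorm_bmul_le.
move=> g1.
have s1 : 1 <= rnorm s := le_trans g1 s_le.
(* The element [s] has norm at least 1 and lies within 1/4 of [c *: u]. *)
have c_ge : 3 / 4 <= Normc.normc c.
  have := rnormD (s - c *: u) (c *: u); rewrite subrK rnormZ.
  have : Normc.normc c * rnorm u <= Normc.normc c * 1.
    by rewrite ler_wpM2l // normc_ge0.
  by move=> *; lra.
case: uu' => [uu'|c0]; last by move: c_ge; rewrite c0 Normc.normc0 leNgt divr_gt0.
have gv : g ** v = s by rewrite gs -bmulA v'v mule.
have gs_s : g ** s = s by rewrite -{1}gv bmulA gg.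
have gb : g ** b k = g by rewrite /g -bmulA -vbv'b -/q bmulA b_idem.
have bs : b k ** s = s by rewrite /s !bmulA b_idem.
(* The product [x ** s] vanishes, while [c *: u] times [u'] is [c *: b k]. Hence [c *: x] is [x]
   times an element of norm at most 1/4, and |c| >= 3/4 forces x = 0. *)
set x := b k - g.
suff x0 : x = 0 by apply/esym/eqP; rewrite -subr_eq0 -/x x0.
have xE : c *: x = x ** ((c *: u - s) ** u').
  have -> : (c *: u - s) ** u' = c *: b k - s ** u'.
    by rewrite bmulBl bmulZl uu'.
  have xb : x ** b k = x by rewrite bmulBl b_idem gb.
  have xs : x ** s = 0 by rewrite bmulBl bs gs_s subrr.
  by rewrite bmulBr bmulZr xb bmulA xs bmul0l subr0.
have small : rnorm ((c *: u - s) ** u') <= 4^-1.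
  by rewrite -[4^-1]mulr1; apply: rnorm_bmul_le => //; rewrite rnormB.
have : Normc.normc c * rnorm x <= rnorm x * 4^-1.
  by rewrite -rnormZ xE; apply: rnorm_bmul_le.
have : 3 / 4 * rnorm x <= Normc.normc c * rnorm x.
  by rewrite ler_wpM2r // rnorm_ge0.
move=> h1 h2; apply: (@rnorm_contracted _ _ x (1 / 3)); first by lra.
by have := rnorm_ge0 x; lra.
Qed.

(** The elements b_k v b_l v^-1 sum over l to b_k, which is nonzero. Some term is therefore nonzero,
    hence equal to b_k; multiply it by v on the right. *)
Lemma intertwine k : exists l, b k ** v = b k ** v ** b l.
Proof.
have [l hl] : exists l, b k ** (v ** b l ** v') != 0.
  apply/existsP; rewrite -[X in is_true X]negbK negb_exists.
  apply/negP => /forallP h; have /eqP := b_neq0 k; apply.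
  have -> : b k = \sum_l b k ** (v ** b l ** v').
    by rewrite -bmul_sumr -bmul_suml -bmul_sumr sum_b mule vv' mule.
  by apply: big1 => l _; apply/eqP; rewrite -[_ == _]negbK h.
exists l; have [h|h] := conjugate_zero_or_full k l; first by rewrite h eqxx in hl.
by rewrite -{1}h -!bmulA v'v mule.
Qed.

Let vpow n := iter n (fun x => x ** v) e.

Let vpow_le1 n : rnorm (vpow n) <= 1.
Proof.
elim: n => [|n IH] /=; last by rewrite -[1]mulr1; apply: rnorm_bmul_le.
by rewrite -vv' -[1]mulr1; apply: rnorm_bmul_le.
Qed.

Let w_vpow n : w ** vpow n = lam ^+ n *: (vpow n ** w).
Proof.
elim: n => [|n IH] /=; first by rewrite expr0 scale1r emul mule.
by rewrite bmulA IH bmulZl -bmulA wv bmulZr scalerA -exprSr bmulA.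
Qed.

Let b_vpow_ge1 k n : 1 <= rnorm (b k ** vpow n).
Proof.
elim: n => [|n IH] /=; first by rewrite mule.
apply: le_trans IH _.
have -> : b k ** vpow n = b k ** (vpow n ** v) ** v'.
  by rewrite -!bmulA vv' mule.
by rewrite -[leRHS]mulr1; apply: rnorm_bmul_le.
Qed.

(** Let V = v^n and r = b_k w - c b_k, of norm at most 1/4. Moving w past V gives c (1 - lam^n) b_k
    V = lam^n b_k V r - r V, of norm at most 1/2. As |c| >= 3/4 and b_k V has norm at least 1, the
    quotient 2/3 results. *)
Lemma periodic_power_near1 k n : b k ** vpow n = b k ** vpow n ** b k ->
  Normc.normc (1 - lam ^+ n) <= 2 / 3.
Proof.
move=> kn; have [c cE] := a'_diag k.
(* Since w commutes with [b k], this difference is the corner of [w - a'] at [b k]. *)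
have bw : rnorm (b k ** w - c *: b k) <= 4^-1.
  have -> : b k ** w - c *: b k = b k ** (w - a') ** b k.
    by rewrite bmulBr bmulBl cE -bmulA wb bmulA b_idem.
  by rewrite -[4^-1]mulr1 -[4^-1]mul1r; do 2?apply: rnorm_bmul_le.
have bw1 : 1 <= rnorm (b k ** w).
  apply: le_trans (rb k) _; rewrite -{1}[b k]mule -ww' bmulA -[leRHS]mulr1.
  exact: rnorm_bmul_le.
have c_ge : 3 / 4 <= Normc.normc c.
  have := rnormD (b k ** w - c *: b k) (c *: b k); rewrite subrK rnormZ.
  have : Normc.normc c * rnorm (b k) <= Normc.normc c * 1.
    by rewrite ler_wpM2l // normc_ge0.
  by move=> *; lra.
set V := vpow n in kn *.
have VE : (c * (1 - lam ^+ n)) *: (b k ** V) =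
    lam ^+ n *: (b k ** V ** (b k ** w - c *: b k))
    - (b k ** w - c *: b k) ** V.
  rewrite bmulBr bmulBl bmulZl bmulZr -kn [b k ** V ** (b k ** w)]bmulA -kn.
  rewrite -[b k ** w ** V]bmulA w_vpow bmulZr [b k ** (V ** w)]bmulA scalerBr.
  rewrite opprB [RHS]addrC addrA subrK.
  by rewrite mulrBr mulr1 scalerBl scalerA mulrC.
have lamn : Normc.normc (lam ^+ n) = 1.
  elim: (n) => [|m IH]; first by rewrite expr0 Normc.normc1.
  by rewrite exprS Normc.normcM lam1 IH mulr1.
have le_half : Normc.normc (c * (1 - lam ^+ n)) * rnorm (b k ** V) <= 2^-1.
  rewrite -rnormZ VE; apply: le_trans (rnormD _ _) _; rewrite rnormN rnormZ lamn mul1r.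
  have h1 : rnorm (b k ** V ** (b k ** w - c *: b k)) <= 1 * 1 * 4^-1.
    by do 2?apply: rnorm_bmul_le => //; exact: vpow_le1.
  have h2 : rnorm ((b k ** w - c *: b k) ** V) <= 4^-1 * 1.
    by apply: rnorm_bmul_le => //; exact: vpow_le1.
  by lra.
have : Normc.normc (c * (1 - lam ^+ n)) * 1 <= 2^-1.
  apply: le_trans le_half; rewrite ler_wpM2l ?normc_ge0 //; exact: b_vpow_ge1.
rewrite mulr1 Normc.normcM => h.
have : 3 / 4 * Normc.normc (1 - lam ^+ n) <=
    Normc.normc c * Normc.normc (1 - lam ^+ n).
  by rewrite ler_wpM2r // normc_ge0.
by move=> *; lra.
Qed.

Lemma rotation_number_torsion : exists2 n, (0 < n)%N & lam ^+ n = 1.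
Proof.
have [sigma hsigma] : exists sigma, forall k, b k ** v = b k ** v ** b (sigma k).
  by have [f hf] := choice intertwine; exists f.
have iterE k n : b k ** vpow n = b k ** vpow n ** b (iter n sigma k).
  elim: n => [|n IH] /=; first by rewrite mule b_idem.
  by rewrite bmulA IH -!bmulA [b _ ** v]hsigma !bmulA.
(* Pigeonhole on the first |K| + 1 iterates of [k0]. *)
have [k [n n0 nk]] : exists k, exists2 n, (0 < n)%N & iter n sigma k = k.
  pose f (m : 'I_#|K|.+1) := iter m sigma k0.
  have /injectivePn[i [j ij fij]] : ~~ injectiveb f.
    apply/negP => /injectiveP /leq_card; rewrite card_ord.
    by rewrite ltnn.
  wlog lij : i j ij fij / (i < j)%N.
    move=> H; have [|ji|ijE] := ltngtP i j; first exact: H.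
      by apply: (H j i) => //; rewrite eq_sym.
    by move: ij; rewrite -val_eqE /= ijE eqxx.
  exists (f i); exists (j - i)%N; first by rewrite subn_gt0.
  by rewrite /f -iterD subnK ?(ltnW lij) // -[RHS]/(f i) fij.
(* Multiples of a period are periods, so every power of lam^n stays near 1. *)
have nmk m : iter (n * m) sigma k = k.
  by elim: m => [|m IH]; [rewrite muln0 | rewrite mulnS iterD IH].
exists n => //; apply: normc_1B_powers => m; rewrite -exprM.
by apply: (@periodic_power_near1 k); rewrite {1}iterE nmk.
Qed.

End rotation_relation.

Lemma linear_map0 (R : realType) (U V : lmodType R[i]) (f : U -> V) :
  linear f -> f 0 = 0.
Proof. by move=> lf; have := lf (-1) 0 0; rewrite scaler0 addr0 scaleN1r addNr. Qed.

(** * The operator norm *)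

Section operator_norm.
Variables (R : realType) (E : normedModType R[i]).
Implicit Types T : E -> E.

Lemma opnorm_le T (c : R) : 0 <= c -> (forall x, rnorm (T x) <= c * rnorm x) ->
  opnorm T <= c.
Proof.
move=> c0 Tc; apply: ge_sup.
  by exists (rnorm (T 0)); exists 0 => //=; rewrite rnorm0.
move=> _ [x /= x1 <-]; apply: le_trans (Tc x) _.
by rewrite -[leRHS]mulr1 ler_wpM2l.
Qed.

Lemma opnorm_ub T x : bounded_operator T -> rnorm x <= 1 -> rnorm (T x) <= opnorm T.
Proof.
move=> [_ [M TM]] x1; apply: ub_le_sup; last by exists x.
(* [M] may be negative when [E] is the zero space. *)
exists (Num.max M 0) => _ [y /= y1 <-]; apply: le_trans (TM y) _.
rewrite le_max; have [M0|M0] := leP 0 M.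
  by apply/orP; left; rewrite -[leRHS]mulr1 ler_wpM2l.
by apply/orP; right; rewrite nmulr_rle0 // rnorm_ge0.
Qed.

Lemma rnorm_le_opnorm T x : bounded_operator T ->
  rnorm (T x) <= opnorm T * rnorm x.
Proof.
move=> bT; have [lT _] := bT.
have [->|x0] := eqVneq x 0.
  by rewrite (linear_map0 lT) rnorm0 mulr0.
have nx : 0 < rnorm x.
  rewrite lt_neqAle rnorm_ge0 andbT eq_sym.
  by apply: contra_neq x0; exact: rnorm_eq0.
pose c : R[i] := ((rnorm x)^-1)%:C.
have nc : Normc.normc c = (rnorm x)^-1 by rewrite normc_real gtr0_norm ?invr_gt0.
have TZ : T (c *: x) = c *: T x.
  by have := lT c x 0; rewrite (linear_map0 lT) !addr0.
have := TZ; move/(congr1 (@rnorm R E)); rewrite rnormZ nc => h.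
rewrite -ler_pdivrMr // mulrC -h.
by apply: opnorm_ub => //; rewrite rnormZ nc mulVf ?gt_eqF.
Qed.

Lemma bounded_idfun : bounded_operator (@idfun E).
Proof. by split => //; exists 1 => x; rewrite mul1r. Qed.

Lemma contraction_bounded T : linear T -> (forall x, rnorm (T x) <= rnorm x) ->
  bounded_operator T.
Proof. by move=> lT T1; split => //; exists 1 => x; rewrite mul1r. Qed.

End operator_norm.

(** * Matrix units of a sum of matrix algebras *)

Section matrix_units.
Variables (R : realType) (p : R) (p1 : 1 < p).
Variables (m : nat) (n : 'I_m -> nat).
Let p_gt0 : 0 < p. Proof. exact: lt_trans p1. Qed.

Local Notation K := {i : 'I_m & 'I_(n i)}.
Local Notation L i := (lp (ltW p1) 'I_(n i)).
Local Notation tagged_ord j := (Tagged (fun i : 'I_m => 'I_(n i)) j).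

(* Both [delta i k] and [coord i k] vanish unless k lies in the i-th block, so
   that [munit k l] is zero when k and l lie in different blocks. *)
Definition delta (i : 'I_m) (k : K) : L i :=
  lp_fin (ltW p1) (fun j => (tagged_ord j == k)%:R).

Definition coord (i : 'I_m) (k : K) (x : L i) : R[i] :=
  \sum_(j | tagged_ord j == k) x j.

Definition munit (k l : K) (i : 'I_m) (x : L i) : L i :=
  coord l x *: delta i k.

Lemma munitE k l i (x : L i) j :
  munit k l x j = coord l x * (tagged_ord j == k)%:R.
Proof. by []. Qed.

Lemma delta_off i k : i != tag k -> delta i k = 0.
Proof.
move=> ik; apply: val_inj; apply/funext => j /=.
by case: eqP => // jk; move: ik; rewrite -jk /= eqxx.
Qed.

Lemma coord_off i k (x : L i) : i != tag k -> coord k x = 0.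
Proof.
move=> ik; apply: big_pred0 => j; apply/eqP => jk.
by move: ik; rewrite -jk /= eqxx.
Qed.

Lemma coordE i (j : 'I_(n i)) (x : L i) : coord (tagged_ord j) x = x j.
Proof. by rewrite /coord (big_pred1 j) // => j'; rewrite eq_Tagged. Qed.

Lemma coord_linear i k (c : R[i]) (x y : L i) :
  coord k (c *: x + y) = c * coord k x + coord k y.
Proof. by rewrite /coord mulr_sumr -big_split. Qed.

Lemma coordZ i k (c : R[i]) (x : L i) : coord k (c *: x) = c * coord k x.
Proof. by rewrite /coord mulr_sumr. Qed.

Lemma coord_delta (k : K) : coord k (delta (tag k) k) = 1.
Proof. by case: k => i j; rewrite coordE /= eqxx. Qed.

Lemma munit_linear k l i : linear (@munit k l i).
Proof. by move=> c x y; rewrite /munit coord_linear scalerDl scalerA. Qed.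

Lemma rnorm_delta i k : rnorm (delta i k) <= 1.
Proof.
have [->|] := eqVneq i (tag k); last by move/delta_off->; rewrite rnorm0.
case: k => {}i j /=; rewrite ?rnorm_lp; apply: lp_norm_le => //.
rewrite lp_sum_fin lee_fin powR1 /psum (bigD1 j) //= eqxx Normc.normc1 powR1.
rewrite big1 ?addr0 // => j' j'j; rewrite eq_Tagged /= (negbTE j'j).
by rewrite Normc.normc0 powR0 // gt_eqF.
Qed.

Lemma normc_lp (I : finType) (x : lp (ltW p1) I) j : Normc.normc (x j) <= rnorm x.
Proof.
rewrite leNgt; apply/negP => h.
have : lp_norm x `^ p < Normc.normc (x j) `^ p.
  by apply: gt0_ltr_powR => //; rewrite nnegrE ?lp_norm_ge0 ?normc_ge0.
rewrite lp_norm_psum /psum (bigD1 j) //= ltNge lerDl sumr_ge0 // => i _.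
exact: powR_ge0.
Qed.

Lemma normc_coord i k (x : L i) : Normc.normc (coord k x) <= rnorm x.
Proof.
have [ik|/coord_off->] := eqVneq i (tag k); last by rewrite Normc.normc0 rnorm_ge0.
by case: k ik => i' j /= ik; case: _ / ik j => j; rewrite coordE normc_lp.
Qed.

Lemma rnorm_munit k l i (x : L i) : rnorm (munit k l x) <= rnorm x.
Proof.
rewrite rnormZ -[leRHS]mulr1; apply: ler_pM; rewrite ?normc_ge0 ?rnorm_ge0 //.
  exact: normc_coord.
exact: rnorm_delta.
Qed.

Lemma munit_comp k l i (x : L i) : tag k = tag l ->
  munit k l (munit l k x) = munit k k x.
Proof.
move=> kl; rewrite /munit coordZ.
case: (eqVneq i (tag k)) x => [->|ik] x; last by rewrite (delta_off ik) !scaler0.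
have cl : coord l (delta (tag k) l) = 1 by rewrite kl coord_delta.
by rewrite cl mulr1.
Qed.

(** Compression between two diagonal units isolates one matrix entry; this supplies [a'_diag] and
    [a_entry]. *)
Lemma munit_sandwich k l : exists c : (forall i, L i -> L i) -> R[i],
  forall T, (forall i, linear (T i)) ->
    (forall i (x : L i), munit k k (T i (munit l l x)) = c T *: munit k l x) /\
    (tag k = tag l \/ c T = 0).
Proof.
(* The witness is the entry (k, l) of T in the block of k; it vanishes with [delta (tag k) l] when l
   belongs to another block. *)
exists (fun T : forall i, L i -> L i => coord k (T (tag k) (delta (tag k) l))) => T lT; split=> [i x|].
  case: (eqVneq i (tag k)) x => [->|ik] x; last by rewrite /munit (delta_off ik) !scaler0.
  rewrite {2}/munit; have -> : T (tag k) (coord l x *: delta (tag k) l) =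
      coord l x *: T (tag k) (delta (tag k) l).
    have := lT (tag k) (coord l x) (delta (tag k) l) 0.
    by rewrite (linear_map0 (lT _)) !addr0.
  by rewrite /munit coordZ scalerA mulrC.
have [|kl] := eqVneq (tag k) (tag l); [by left | right].
by rewrite (delta_off kl) (linear_map0 (lT _)) /coord big1.
Qed.

Lemma munit_sum i (x : L i) : \sum_k munit k k x = x.
Proof.
apply: val_inj; apply/funext => j.
have appD : {morph (fun y : L i => y j) : y z / y + z} by [].
have app0 : (0 : L i) j = 0 by [].
rewrite -[LHS]/((\sum_k munit k k x : L i) j) (big_morph (fun y : L i => y j) appD app0).
rewrite (bigD1 (tagged_ord j)) // big1 ?addr0.
  by rewrite munitE coordE eqxx mulr1; exact: addr0.
by move=> k kj; rewrite -[LHS]/(munit k k x j) munitE eq_sym (negbTE kj) mulr0.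
Qed.

(** The operator 1 + (z - 1) E_kk multiplies coordinate k by z and fixes the others, so it preserves
    all moduli. *)
Lemma munit_hermitian k (z : R[i]) i (x : L i) : Normc.normc z = 1 ->
  rnorm (x + (z - 1) *: munit k k x) <= rnorm x.
Proof.
move=> z1; rewrite ?rnorm_lp; apply: lp_norm_le; first exact: lp_norm_ge0.
rewrite lp_sum_fin lee_fin lp_norm_psum; apply: ler_sum => j _.
have -> : (x + (z - 1) *: munit k k x) j =
    x j + (z - 1) * munit k k x j by [].
rewrite munitE.
have [<-|_] := eqVneq; last by rewrite !mulr0 addr0.
by rewrite coordE mulr1 mulrBl mul1r addrC subrK Normc.normcM z1 mul1r.
Qed.

Lemma munit_delta k : munit k k (delta (tag k) k) = delta (tag k) k.
Proof. by rewrite /munit coord_delta scale1r. Qed.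

Lemma delta_neq0 k : delta (tag k) k != 0.
Proof.
apply/eqP => d0; have := coord_delta k; rewrite d0 /coord big1 // => /eqP.
by rewrite eq_sym oner_eq0.
Qed.

End matrix_units.

(** * Computing in a sum of matrix algebras through its isomorphism *)

Section matrix_sums.
Variables (R : realType) (p : R) (p1 : 1 < p).
Variables (A : banachAlgType R[i]) (m : nat) (n : 'I_m -> nat).
Variable Psi : A -> forall i : 'I_m,
  lp (ltW p1) 'I_(n i) -> lp (ltW p1) 'I_(n i).
Hypothesis iso : matrix_sum_isomorphism Psi.
Implicit Types a b d : A.

Lemma msum_linearE (c : R[i]) a b i x :
  Psi (c *: a + b) x = c *: Psi a (i := i) x + Psi b x.
Proof. by rewrite (msum_linear iso). Qed.

Lemma msum_mulE a b i x : Psi (a ** b) (i := i) x = Psi a (Psi b x).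
Proof. by rewrite (msum_mul iso). Qed.

Lemma msum_op_linear a i : linear (@Psi a i).
Proof. by case: (msum_bounded iso a i). Qed.

Lemma msumDE a b i x : Psi (a + b) (i := i) x = Psi a x + Psi b x.
Proof. by rewrite -[a]scale1r msum_linearE !scale1r. Qed.

Lemma msum0E i x : Psi 0 (i := i) x = 0.
Proof.
by have := msum_linearE (-1) 0 0 x; rewrite scaler0 addr0 scaleN1r addNr.
Qed.

Lemma msumZE (c : R[i]) a i x : Psi (c *: a) (i := i) x = c *: Psi a x.
Proof. by rewrite -[c *: a]addr0 msum_linearE msum0E addr0. Qed.

Lemma msumBE a b i x : Psi (a - b) (i := i) x = Psi a x - Psi b x.
Proof. by rewrite -scaleN1r msumDE msumZE scaleN1r. Qed.

Lemma msum_rnorm_le a (c : R) : 0 <= c ->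
  (forall i x, rnorm (Psi a (i := i) x) <= c * rnorm x) -> rnorm a <= c.
Proof.
move=> c0 ac; rewrite (msum_isometric iso); apply: bigmax_le => // i _.
by apply: opnorm_le.
Qed.

Lemma msum_apply_le a i x : rnorm (Psi a (i := i) x) <= rnorm a * rnorm x.
Proof.
apply: le_trans (rnorm_le_opnorm x (msum_bounded iso a i)) _.
rewrite ler_wpM2r ?rnorm_ge0 // (msum_isometric iso).
by apply: (le_bigmax _ (fun i => opnorm (@Psi a i))).
Qed.

Lemma msum_inj a b : (forall i x, Psi a (i := i) x = Psi b x) -> a = b.
Proof.
move=> ab; apply/eqP; rewrite -subr_eq0; apply/eqP/rnorm_eq0.
apply/eqP; rewrite eq_le rnorm_ge0 andbT; apply: msum_rnorm_le => // i x.
by rewrite msumBE ab subrr rnorm0 mul0r.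
Qed.

Lemma msum_sumE (I : finType) (F : I -> A) i x :
  Psi (\sum_k F k) (i := i) x = \sum_k Psi (F k) x.
Proof.
apply: (big_morph (fun a => @Psi a i x)); last exact: msum0E.
by move=> a b; exact: msumDE.
Qed.

(** The isomorphism is not assumed unital. Surjectivity provides [a0] acting as the identity, and
    [a0 ** a1] equals both [a0] and [a1]. *)
Lemma msum_unitE a1 : is_unit_element a1 ->
  forall i x, Psi a1 (i := i) x = x.
Proof.
move=> ua; have [a0 a0E] := msum_surjective iso (fun i => @bounded_idfun R _).
suff -> : a1 = a0 by move=> i x; rewrite a0E.
rewrite -[RHS](ua a0).2; apply: msum_inj => i x.
by rewrite msum_mulE a0E.
Qed.

End matrix_sums.

(** * Hermitian idempotents and small commutators *)

Definition near_hermitian (R : realType) (B : banachAlgType R[i]) (e : B)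
    (eps : R) (f : B) : Prop :=
  forall z : R[i], Normc.normc z = 1 -> rnorm (e + (z - 1) *: f) <= 1 + eps.

(** The matrix of D is diagonal by [hermitian_off_diagonal], and idempotence makes its entries 0 or
    1. *)
Lemma hermitian_idempotent_diagonal (R : realType) (p : R) (p1 : 1 < p)
    (I : finType) (D : lp (ltW p1) I -> lp (ltW p1) I) : p != 2 ->
  linear D -> near_hermitian_operator 0 D -> (forall x, D (D x) = D x) ->
  exists S : pred I, forall x j, D x j = if S j then x j else 0.
Proof.
move=> p2 lD hD DD.
pose u j : lp (ltW p1) I := lp_fin (ltW p1) (fun i => (i == j)%:R).
pose lam j := D (u j) j.
have DE x j : D x j = x j * lam j.
  (* This is x with its j-th coordinate removed, so that D y vanishes at j. *)
  pose y := (- x j) *: u j + x.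
  have yj i : pred1 j i -> y i = 0.
    move=> /eqP ->; rewrite -[LHS]/(- x j * (j == j)%:R + x j) eqxx mulr1.
    by rewrite addNr.
  have := hermitian_off_diagonal p2 lD hD yj (eqxx j).
  rewrite /y lD -[LHS]/(- x j * lam j + D x j) => /eqP.
  by rewrite addrC mulNr subr_eq0 => /eqP.
have lam01 j : lam j * lam j = lam j by rewrite -{1}[lam j]/(D (u j) j) -DE DD.
exists (fun j => lam j == 1) => x j; rewrite DE; case: eqP => [->|/eqP lj].
  by rewrite mulr1.
have /eqP := lam01 j; rewrite -subr_eq0 -{3}[lam j]mulr1 -mulrBr mulf_eq0.
by rewrite subr_eq0 (negbTE lj) orbF => /eqP ->; rewrite mulr0.
Qed.

Section commutators.
Variables (R : realType) (p : R) (p1 : 1 < p) (p2 : p != 2).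

Lemma near_hermitian_block (A : banachAlgType R[i]) (m : nat)
    (n : 'I_m -> nat)
    (Psi : A -> forall i, lp (ltW p1) 'I_(n i) -> lp (ltW p1) 'I_(n i))
    (a1 a : A) (eps : R) i :
  matrix_sum_isomorphism Psi -> is_unit_element a1 ->
  near_hermitian a1 eps a -> near_hermitian_operator eps (@Psi a i).
Proof.
move=> iso ua ha z z1 x.
have -> : x + (z - 1) *: Psi a i x = Psi (a1 + (z - 1) *: a) i x.
  by rewrite (msumDE iso) (msumZE iso) (msum_unitE iso ua).
apply: le_trans (msum_apply_le iso _ _) _.
by rewrite ler_wpM2r ?rnorm_ge0 // ha.
Qed.

(** In each block [d] is the projection onto a set of coordinates, so d a - a d = d a (1 - d) - (1 -
    d) a d consists of two off-diagonal corners. As [eps] is chosen before the algebra, the bound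
    holds uniformly over all stages of a limit. *)
Lemma commutator_small (delta : R) : 0 < delta ->
  exists2 eps, 0 < eps & forall (A : banachAlgType R[i]) (m : nat)
    (n : 'I_m -> nat)
    (Psi : A -> forall i, lp (ltW p1) 'I_(n i) -> lp (ltW p1) 'I_(n i))
    (a1 a d : A),
  matrix_sum_isomorphism Psi -> is_unit_element a1 ->
  near_hermitian a1 eps a -> near_hermitian a1 0 d -> d ** d = d ->
  rnorm (d ** a - a ** d) <= delta.
Proof.
move=> d0; have halve (s t : R) : 2 * s <= t + t -> s <= t by move=> h; lra.
have thirds (s : R) : delta / 3 * (2 * s) + delta / 3 * s <= delta * s by lra.
(* The parts x - D x and D x have norms at most twice and once that of x, which makes 3 in total. *)
have d3 : 0 < delta / 3 by rewrite divr_gt0.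
have [eps eps0 H] := off_diagonal_small p1 p2 d3.
exists eps => // A m n Psi a1 a d iso ua ha hd dd.
apply: (msum_rnorm_le iso) => [|i x]; first exact: ltW.
have lT : linear (@Psi a i) by exact: (msum_op_linear iso).
have lD : linear (@Psi d i) by exact: (msum_op_linear iso).
have hT := near_hermitian_block iso ua ha (i := i).
have hD := near_hermitian_block iso ua hd (i := i).
have DD y : Psi d i (Psi d i y) = Psi d i y by rewrite -(msum_mulE iso) dd.
rewrite (msumBE iso) !(msum_mulE iso).
move: (@Psi a i) (@Psi d i) lT lD hT hD DD => T D lT lD hT hD DD.
have [S DS] := hermitian_idempotent_diagonal p2 lD hD DD.
have DB y z : D (y - z) = D y - D z.
  by rewrite -scaleN1r addrC lD scaleN1r addrC.
have TB y z : T (y - z) = T y - T z.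
  by rewrite -scaleN1r addrC lT scaleN1r addrC.
pose y := x - D x; pose y' := D x.
have xS : rnorm (D (T y)) <= delta / 3 * rnorm y.
  apply: (H _ T S _ y lT hT) => j; last exact: DS.
  move=> Sj; have -> : y j = x j - D x j by [].
  by rewrite DS Sj subrr.
have xS' : rnorm (T y' - D (T y')) <= delta / 3 * rnorm y'.
  apply: (H _ T (fun j => ~~ S j) _ y' lT hT) => j.
    by move=> Sj; rewrite DS (negbTE Sj).
  have -> : (T y' - D (T y')) j = T y' j - D (T y') j by [].
  by rewrite DS if_neg; case: ifP => _; rewrite ?subrr ?subr0.
(* D is a contraction: 2 D = 1 - (1 - 2 D), and z = -1 bounds 1 - 2 D. *)
have Dx : rnorm y' <= rnorm x.
  have N1 : Normc.normc (-1 : R[i]) = 1 by rewrite normcN Normc.normc1.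
  have := hD (-1) N1 x; rewrite addr0 mul1r => h.
  have : rnorm ((1 + 1 : R[i]) *: D x) <= rnorm x + rnorm x.
    have -> : (1 + 1 : R[i]) *: D x = x - (x + (-1 - 1) *: D x).
      by rewrite opprD addrA subrr add0r -scaleNr opprD !opprK.
    by apply: le_trans (rnormD _ _) _; rewrite rnormN lerD2l.
  rewrite rnormZ; have -> : Normc.normc (1 + 1 : R[i]) = 2.
    have -> : (1 + 1 : R[i]) = 2%:C by rewrite -rmorphD.
    by rewrite normc_real ger0_norm.
  exact: halve.
have yx : rnorm y <= 2 * rnorm x.
  by apply: le_trans (rnormD _ _) _; rewrite rnormN -/y' mulr_natl mulr2n lerD2l.
have -> : D (T x) - T (D x) = D (T y) - (T y' - D (T y')).
  by rewrite /y TB DB /y' opprB addrA subrK.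
apply: le_trans (rnormD _ _) _; rewrite rnormN.
have h1 : delta / 3 * rnorm y <= delta / 3 * (2 * rnorm x).
  by rewrite ler_wpM2l // ltW.
have h2 : delta / 3 * rnorm y' <= delta / 3 * rnorm x.
  by rewrite ler_wpM2l // ltW.
apply: le_trans (lerD (le_trans xS h1) (le_trans xS' h2)) _.
exact: thirds.
Qed.

End commutators.

Lemma linearB (R : realType) (U V : lmodType R[i]) (f : U -> V) x y :
  linear f -> f (x - y) = f x - f y.
Proof. by move=> lf; rewrite -scaleN1r addrC lf scaleN1r addrC. Qed.

Lemma linear_add_scale (R : realType) (U V : lmodType R[i]) (f : U -> V)
  (c : R[i]) x y : linear f -> f (x + c *: y) = f x + c *: f y.
Proof. by move=> lf; rewrite addrC lf addrC. Qed.

Lemma normc_subr1_le2 (R : realType) (z : R[i]) :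
  Normc.normc z = 1 -> Normc.normc (z - 1) <= 2.
Proof.
move=> z1; apply: le_trans (le_normcD z (-1)) _.
by rewrite normcN Normc.normc1 z1.
Qed.

Lemma msum_has_unit (R : realType) (p : R) (p1 : 1 < p) (A : banachAlgType R[i]) :
  is_matrix_sum (ltW p1) A -> exists a1 : A, is_unit_element a1.
Proof.
move=> [m [n [Psi [_ _ iso]]]].
have [a1 a1E] := msum_surjective iso (fun i => @bounded_idfun R _).
exists a1 => a; split; apply: (msum_inj iso) => i x;
by rewrite (msum_mulE iso) a1E.
Qed.

Lemma commutator_perturbation (V : zmodType) (x y u w : V) :
  u - w = (x - y) - ((x - u) - (y - w)).
Proof. by rewrite opprB addrA addrA subrK opprB [RHS]addrC addrA subrK. Qed.

(** * Hermitian elements in spatial AF algebras *)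

Section spatial_AF_limit.
Variables (R : realType) (p : R) (p1 : 1 < p) (p2 : p != 2).
Variables (B : banachAlgType R[i]) (e : B).
Hypothesis he : is_unit_element e.
Variables (A : nat -> banachAlgType R[i]) (iota : forall j, A j -> A j.+1).
Variable gamma : forall j, A j -> B.
Hypothesis A_msum : forall j, is_matrix_sum (ltW p1) (A j).
Hypothesis iota_hom : forall j, algebra_hom (@iota j) /\ isometric (@iota j).
Hypothesis Blim : is_direct_limit iota gamma.

Let glin j : linear (@gamma j).
Proof. exact: (ahom_linear (dlim_hom Blim j)). Qed.

Let gmul j a b : gamma (a ** b) = gamma (j := j) a ** gamma b.
Proof. exact: (ahom_mul (dlim_hom Blim j)). Qed.

Let gB j (a b : A j) : gamma (a - b) = gamma a - gamma b.
Proof. exact: (linearB _ _ (@glin j)). Qed.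

Let gDZ j (c : R[i]) (a b : A j) : gamma (a + c *: b) = gamma a + c *: gamma b.
Proof. exact: (linear_add_scale _ _ _ (@glin j)). Qed.

(** The connecting maps are isometric, so the sequence defining the limit norm is constant. *)
Lemma limit_isometric j (a : A j) : rnorm (gamma a) = rnorm a.
Proof.
have h : (fun k : nat => rnorm (connecting iota k a)) @ \oo --> rnorm (gamma a).
  exact: (dlim_norm Blim).
have c k : rnorm (connecting iota k a) = rnorm a.
  by elim: k => // k IH /=; rewrite (iota_hom _).2.
have h' : (fun k : nat => rnorm (connecting iota k a)) @ \oo --> rnorm a.
  by under eq_fun do rewrite c; exact: cvg_cst.
exact: (cvg_unique _ h h').
Qed.

Let ginj j (a b : A j) : gamma a = gamma b -> a = b.
Proof.
move=> ab; apply/eqP; rewrite -subr_eq0; apply/eqP/rnorm_eq0.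
by rewrite -limit_isometric gB ab subrr rnorm0.
Qed.

Lemma limit_dense (x : B) (eps : R) : 0 < eps ->
  exists j (a : A j), rnorm (x - gamma a) < eps.
Proof.
move=> eps0; have e0 : 0 < eps%:C by rewrite ltcR.
have [] := dlim_dense Blim (O := ball x eps%:C).
- by exists x; exact: ballxx.
- exact: ball_open.
move=> y [xy [j _ [a _ ay]]]; exists j, a; rewrite ay.
by move: xy; rewrite -ball_normE /= rnormE ltcR.
Qed.

Let stage_mono (P : nat -> Prop) : (forall j, P j -> P j.+1) ->
  forall j k, (j <= k)%N -> P j -> P k.
Proof.
move=> step j k; elim: k => [|k IH]; first by rewrite leqn0 => /eqP ->.
by rewrite leq_eqVlt => /orP[/eqP ->//|]; rewrite ltnS => /IH h /h /step.
Qed.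

Let near_mono x (eps : R) j k : (j <= k)%N ->
  (exists a : A j, rnorm (x - gamma a) < eps) ->
  exists a : A k, rnorm (x - gamma a) < eps.
Proof.
apply: (stage_mono (P := fun j => exists a : A j, rnorm (x - gamma a) < eps)).
by move=> i [a xa]; exists (iota a); rewrite (dlim_compatible Blim).
Qed.

Let range_mono x j k : (j <= k)%N -> (exists a : A j, gamma a = x) ->
  exists a : A k, gamma a = x.
Proof.
apply: (stage_mono (P := fun j => exists a : A j, gamma a = x)).
by move=> i [a xa]; exists (iota a); rewrite (dlim_compatible Blim).
Qed.

(** The connecting maps are not assumed unital. If gamma a lies within distance 1 of e and a1 is the
    unit of that stage, then e - gamma a1 = (e - gamma a1) (e - gamma a), which forces e = gamma
    a1. *)
Lemma limit_unit_stage : exists j (a : A j), gamma a = e.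
Proof.
have [j [a ea]] := limit_dense e (@ltr01 R).
have [a1 ua] := msum_has_unit (A_msum j).
exists j, a1; apply/esym/eqP; rewrite -subr_eq0; apply/eqP.
apply: (rnorm_contracted ea); rewrite mulrC.
apply: le_trans (rnorm_bmul _ _).
rewrite bmulBr bmulBl (he _).1 bmulBl -gmul (ua a).1 (he _).1 subrr subr0.
by rewrite (he (gamma a1)).2.
Qed.

Let stage_unit j (a : A j) : gamma a = e -> is_unit_element a.
Proof.
by move=> ae b; split; apply: ginj; rewrite gmul ae; case: (he (gamma b)).
Qed.

(** An approximant of f in a late stage is nearly hermitian there, hence nearly commutes with d by
    [commutator_small], whose constant does not depend on the stage. *)
Lemma hermitian_commute (f : B) j (d : A j) :
  near_hermitian e 0 f -> near_hermitian e 0 (gamma d) -> d ** d = d ->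
  gamma d ** f = f ** gamma d.
Proof.
move=> hf hd dd; set D := gamma d in hd *.
apply/eqP; rewrite -subr_eq0; apply/eqP/rnorm_eq0/eqP.
rewrite eq_le rnorm_ge0 andbT; apply/ler_addgt0Pl => delta d0; rewrite addr0.
have bound (s t q r1 r2 u : R) : t <= delta / 2 -> s <= t + q ->
    q <= r1 + r2 -> r1 <= u -> r2 <= u -> 4 * u <= delta -> s <= delta.
  by move=> *; lra.
have d2 : 0 < delta / 2 by rewrite divr_gt0.
have [eps eps0 H] := commutator_small p1 p2 d2.
have D1 : 0 < 1 + rnorm D by rewrite ltr_wpDr ?rnorm_ge0.
(* The first bound is for |z - 1| <= 2. The second makes the two error terms, each at most eta times
   the norm of D, add up to at most delta / 2. *)
pose eta := Num.min (eps / 2) (delta / (4 * (1 + rnorm D))).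
have eta0 : 0 < eta by rewrite lt_min !divr_gt0 // mulr_gt0.
have eta_eps : 2 * eta <= eps by rewrite mulrC -ler_pdivlMr // ge_min lexx.
have eta_D : 4 * (eta * rnorm D) <= delta.
  have : eta * (4 * (1 + rnorm D)) <= delta.
    by rewrite -ler_pdivlMr ?mulr_gt0 // ge_min lexx orbT.
  by apply: le_trans; lra.
have [j1 near1] := limit_dense f eta0.
have [j2 unit2] := limit_unit_stage.
(* A common stage for [d], the approximant of f and the unit. *)
pose J := maxn j (maxn j1 j2).
have jJ : (j <= J)%N by rewrite leq_maxl.
have j1J : (j1 <= J)%N by rewrite /J !leq_max leqnn !orbT.
have j2J : (j2 <= J)%N by rewrite /J !leq_max leqnn !orbT.
have [a fa] := near_mono j1J near1.
have [a1 a1e] := range_mono j2J unit2.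
have [d' d'D] := range_mono jJ (ex_intro (fun b => gamma b = D) d erefl).
have ua := stage_unit a1e.
have [m [n [Psi [_ _ iso]]]] := A_msum J.
have d'd' : d' ** d' = d' by apply: ginj; rewrite gmul d'D /D -gmul dd.
have fa' : rnorm (gamma a - f) <= eta by rewrite rnormB ltW.
have ha : near_hermitian a1 eps a.
  move=> z z1; rewrite -limit_isometric gDZ a1e.
  have -> : e + (z - 1) *: gamma a =
      (e + (z - 1) *: f) + (z - 1) *: (gamma a - f).
    by rewrite scalerBr -addrA [X in _ = e + X]addrC subrK.
  apply: le_trans (rnormD _ _) _; rewrite rnormZ.
  have := hf z z1; rewrite addr0 => h1.
  apply: lerD h1 _; apply: le_trans eta_eps.
  by apply: ler_pM; rewrite ?normc_ge0 ?rnorm_ge0 ?normc_subr1_le2.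
have hd' : near_hermitian a1 0 d'.
  move=> z z1; rewrite -limit_isometric gDZ a1e d'D.
  exact: hd.
have h := H _ _ _ _ _ _ _ iso ua ha hd' d'd'.
rewrite -limit_isometric gB !gmul d'D in h.
have DE : D ** f - f ** D = (D ** gamma a - gamma a ** D)
    - (D ** (gamma a - f) - (gamma a - f) ** D).
  by rewrite bmulBr bmulBl; exact: commutator_perturbation.
have h1 := rnormD (D ** gamma a - gamma a ** D)
    (- (D ** (gamma a - f) - (gamma a - f) ** D)).
have h2 := rnormD (D ** (gamma a - f)) (- ((gamma a - f) ** D)).
rewrite rnormN in h1; rewrite rnormN in h2.
have h3 : rnorm (D ** (gamma a - f)) <= rnorm D * eta.
  exact: rnorm_bmul_le.
have h4 : rnorm ((gamma a - f) ** D) <= eta * rnorm D.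
  exact: rnorm_bmul_le.
rewrite [rnorm D * eta]mulrC in h3.
by rewrite -DE in h1; exact: bound h h1 h2 h3 h4 eta_D.
Qed.

(** Applies [rotation_number_torsion] to the diagonal matrix units of a single stage close to v and
    w. Writing w through the hermitian f1 and f2 makes it commute with them. *)
Lemma limit_torsion (v v' w w' f1 f2 : B) (lam : R[i]) :
  rnorm v <= 1 -> rnorm v' <= 1 -> rnorm w' <= 1 ->
  v ** v' = e -> v' ** v = e -> w ** w' = e ->
  Normc.normc lam = 1 -> w ** v = lam *: (v ** w) ->
  near_hermitian e 0 f1 -> near_hermitian e 0 f2 ->
  w = (2%:R *: f1 - e) + 'i *: (2%:R *: f2 - e) ->
  exists2 N, (0 < N)%N & lam ^+ N = 1.
Proof.
move=> v1 v'1 w'1 vv' v'v ww' lam1 wv hf1 hf2 wE.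
have q0 : 0 < 4^-1 :> R by rewrite invr_gt0.
have [j1 near_v] := limit_dense v q0; have [j2 near_w] := limit_dense w q0.
have [j3 unit3] := limit_unit_stage.
pose J := maxn j1 (maxn j2 j3).
have j1J : (j1 <= J)%N by rewrite leq_maxl.
have j2J : (j2 <= J)%N by rewrite /J !leq_max leqnn !orbT.
have j3J : (j3 <= J)%N by rewrite /J !leq_max leqnn !orbT.
have [a va] := near_mono j1J near_v; have [a' wa'] := near_mono j2J near_w.
have [a1 a1e] := range_mono j3J unit3.
have ua := stage_unit a1e.
have [m [n [Psi [m0 n0 iso]]]] := A_msum J.
pose K : finType := {i : 'I_m & 'I_(n i)}.
pose k0 : K := Tagged (fun i => 'I_(n i)) (Ordinal (n0 (Ordinal m0))).
have /choice[U UE] : forall kl : K * K, exists b : A J, forall i,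
    Psi b i = munit (p1 := p1) kl.1 kl.2 (i := i).
  move=> kl; apply: (msum_surjective iso) => i; apply: contraction_bounded.
    exact: munit_linear.
  exact: rnorm_munit.
have U1 k l : rnorm (gamma (U (k, l))) <= 1.
  rewrite limit_isometric; apply: (msum_rnorm_le iso) => // i x.
  by rewrite UE mul1r rnorm_munit.
pose b k := gamma (U (k, k)).
have Uidem k : U (k, k) ** U (k, k) = U (k, k).
  by apply: (msum_inj iso) => i x; rewrite (msum_mulE iso) UE munit_comp.
have b_idem k : b k ** b k = b k by rewrite /b -gmul Uidem.
have b_neq0 k : b k != 0.
  apply/eqP => bk; have /eqP := delta_neq0 p1 k; apply.
  have : U (k, k) = 0 by apply: ginj; rewrite -[LHS]/(b k) bk (linear_map0 (@glin J)).
  move/(congr1 (fun c => Psi c (tag k) (delta p1 (tag k) k))).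
  by rewrite UE munit_delta (msum0E iso).
have sum_b : \sum_k b k = e.
  have -> : \sum_k b k = gamma (\sum_k U (k, k)).
    symmetry; apply: (big_morph (@gamma J)); last exact: (linear_map0 (@glin J)).
    by move=> x y; rewrite -[y]scale1r gDZ !scale1r.
  rewrite -a1e; congr gamma; apply: (msum_inj iso) => i x.
  rewrite (msum_sumE iso) (msum_unitE iso ua) -[RHS]munit_sum.
  by apply: eq_bigr => k _; rewrite UE.
have b_herm k : near_hermitian e 0 (b k).
  move=> z z1; rewrite -a1e -gDZ limit_isometric addr0.
  apply: (msum_rnorm_le iso) => // i x.
  rewrite (msumDE iso) (msumZE iso) (msum_unitE iso ua) UE mul1r.
  exact: munit_hermitian.
have entry (c : A J) k l : exists t, b k ** gamma c ** b l = t *: gamma (U (k, l))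
    /\ (tag k = tag l \/ t = 0).
  have [t /(_ (Psi c))[|tE tk]] :=
    munit_sandwich p1 k l; first by move=> i; exact: (msum_op_linear iso).
  exists (t (Psi c)); split=> //.
  rewrite -!gmul -[_ *: _]add0r -(linear_map0 (@glin J)) -gDZ add0r.
  congr gamma; apply: (msum_inj iso) => i x.
  by rewrite !(msum_mulE iso) (msumZE iso) !UE tE.
have b_comm f k : near_hermitian e 0 f -> f ** b k = b k ** f.
  by move=> hf; rewrite (hermitian_commute hf (b_herm k) (Uidem k)).
apply: (@rotation_number_torsion R B e he v v' w w' lam v1 v'1 w'1 vv' v'v ww'
  lam1 wv K k0 b b_idem b_neq0 _ sum_b (gamma a) (gamma a')).
- by move=> k; exact: U1.
- exact: ltW.
- exact: ltW.
- by move=> k; have [t [-> _]] := entry a' k k; exists t.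
- move=> k l; have [t [-> kl]] := entry a k l.
  exists t, (gamma (U (k, l))), (gamma (U (l, k))); split=> //.
  case: kl => [kl|]; [left | by right].
  rewrite -gmul; congr gamma; apply: (msum_inj iso) => i x.
  by rewrite (msum_mulE iso) !UE munit_comp.
- move=> k; have h f : near_hermitian e 0 f ->
      (2%:R *: f - e) ** b k = b k ** (2%:R *: f - e).
    move=> hf; rewrite bmulBl bmulBr bmulZl bmulZr (b_comm _ k hf).
    by rewrite (he (b k)).1 (he (b k)).2.
  by rewrite wE bmulDl bmulDr bmulZl bmulZr !h.
(* Conjugation by the contractions v and v^-1 preserves hermitian elements. *)
- move=> k l; apply/esym/b_comm => z z1.
  have -> : e + (z - 1) *: (v ** b l ** v') = v ** (e + (z - 1) *: b l) ** v'.
    by rewrite bmulDr bmulDl bmulZr bmulZl (he v).2 vv'.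
  have h := b_herm l z z1; rewrite addr0 in h *.
  apply: le_trans (rnorm_bmul_le (rnorm_bmul_le v1 h) v'1) _.
  by rewrite !mulr1.
Qed.

End spatial_AF_limit.

(** * Roots of unity on the circle and irrationality *)

Section circle_exponential.
Variable R : realType.
Implicit Types s t : R.

Lemma normc_expi t : Normc.normc (expi t) = 1.
Proof. by rewrite /= cos2Dsin2 sqrtr1. Qed.

Lemma expiD s t : expi (s + t) = expi s * expi t.
Proof. by rewrite /expi cosD sinD; congr (_ +i* _); rewrite addrC mulrC. Qed.

Lemma expi_exp t N : expi t ^+ N = expi (N%:R * t).
Proof.
elim: N => [|N IH]; first by rewrite mul0r /expi cos0 sin0 expr0.
by rewrite exprS IH -expiD mulrSr mulrDl mul1r addrC.
Qed.

Lemma sin_pi_int (k : int) : sin (pi * k%:~R : R) = 0.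
Proof.
have nat_case (j : nat) : sin (pi * j%:R : R) = 0.
  elim: j => [|j IH]; first by rewrite mulr0 sin0.
  by rewrite -natr1 mulrDr mulr1 sinDpi IH oppr0.
by case: k => j; rewrite ?NegzE ?mulrNz ?mulrN ?sinN -pmulrn nat_case ?oppr0.
Qed.

(** Subtract the floor of t: as sin is positive on the open interval from 0 to pi, the fractional
    part is 0. *)
Lemma sin_pi_eq0 t : sin (pi * t) = 0 -> t = (Num.floor t)%:~R.
Proof.
move=> st; have /andP[] := floor_itv t; move: (Num.floor t) => k kt tk.
apply/eqP; rewrite -subr_eq0.
have s0 : 0 <= t - k%:~R by rewrite subr_ge0.
have s1 : t - k%:~R < 1 by rewrite ltrBlDl -[1]/(1%:~R) -intrD.
move: s0; rewrite le_eqVlt => /predU1P[<- //|s0].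
have : 0 < sin (pi * (t - k%:~R)).
  apply: sin_gt0_pi; rewrite mulr_gt0 ?pi_gt0 //=.
  by rewrite -[X in _ < X]mulr1 ltr_pM2l ?pi_gt0.
by rewrite mulrBr sinB st sin_pi_int mul0r mulr0 subrr ltxx.
Qed.

(** The real part of the equation says cos (2 y) = 1 for y = pi N t, so sin y = 0 and N t is an
    integer. *)
Lemma expi_irrational t N : irrational t -> (0 < N)%N ->
  expi (2 * pi * t) ^+ N <> 1.
Proof.
move=> irr N0; rewrite expi_exp => -[c1 _].
have sq : sin (pi * (N%:R * t)) = 0.
  have := cos_mulr2n (pi * (N%:R * t)).
  have -> : (pi * (N%:R * t)) *+ 2 = N%:R * (2 * pi * t) by ring.
  rewrite c1 cos2sin2 => h; apply/eqP; rewrite -sqrf_eq0; apply/eqP.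
  by lra.
apply: irr; exists ((Num.floor (N%:R * t))%:~R / N%:R) => //.
rewrite fmorph_div /= ratr_int ratr_nat -(sin_pi_eq0 sq) mulrC mulKf //.
by rewrite pnatr_eq0 -lt0n.
Qed.

End circle_exponential.

(** * Contractions of l^p from multipliers and from bijections of the index set *)

Section lp_contractions.
Variables (R : realType) (p : R) (p1 : 1 <= p) (I : choiceType).
Let p_gt0 : 0 < p. Proof. exact: lt_le_trans p1. Qed.

Lemma lp_sum_le (f g : I -> R[i]) :
  (forall k, Normc.normc (f k) <= Normc.normc (g k)) ->
  (lp_sum p f <= lp_sum p g)%E.
Proof.
move=> fg; apply: le_esum => k _; rewrite lee_fin.
by apply: ge0_ler_powR; rewrite ?nnegrE ?normc_ge0 // ltW.
Qed.

Lemma lp_le_memP (f : I -> R[i]) (x : lp p1 I) :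
  (lp_sum p f <= lp_sum p x)%E -> f \in lp_pred p1.
Proof.
move=> fx; rewrite unfold_in; apply: le_lt_trans fx _.
by have := lp_funP x; rewrite unfold_in.
Qed.

Lemma rnorm_lp_sum_le (x y : lp p1 I) :
  (lp_sum p x <= lp_sum p y)%E -> rnorm x <= rnorm y.
Proof.
by move=> xy; apply: lp_norm_le; rewrite ?lp_norm_ge0 // -lp_normE.
Qed.

Section multiplication.
Variables (g : I -> R[i]) (g1 : forall k, Normc.normc (g k) <= 1).

Let mul_le (x : lp p1 I) k : Normc.normc (g k * x k) <= Normc.normc (x k).
Proof.
by rewrite Normc.normcM -[leRHS]mul1r ler_wpM2r ?normc_ge0.
Qed.

Definition lp_mul (x : lp p1 I) : lp p1 I :=
  Lp (lp_le_memP (lp_sum_le (mul_le x))).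
End multiplication.

Section composition.
Variables (s : I -> I) (s_bij : bijective s).

Let comp_sum (x : lp p1 I) : lp_sum p (fun k => x (s k)) = lp_sum p x.
Proof.
rewrite /lp_sum [RHS](@reindex_esum R I I setT setT s) //.
have [s' sK s'K] := s_bij; split=> //.
- by move=> k k' _ _ /(can_inj sK).
- by move=> k _ /=; exists (s' k).
Qed.

Let comp_le (x : lp p1 I) :
  (lp_sum p (fun k => x (s k)) <= lp_sum p x)%E.
Proof. by rewrite comp_sum. Qed.

Definition lp_comp (x : lp p1 I) : lp p1 I := Lp (lp_le_memP (comp_le x)).

Lemma rnorm_lp_comp x : rnorm (lp_comp x) <= rnorm x.
Proof. exact/rnorm_lp_sum_le/comp_le. Qed.
End composition.

End lp_contractions.

Lemma lipschitz_continuous_on_circle (R : realType) (f : R[i]^o -> R[i]^o) :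
  (forall x y, Normc.normc (f x - f y) <= Normc.normc (x - y)) ->
  continuous_on_circle f.
Proof.
move=> fL; apply: continuous_subspaceT => x.
apply/(cvgrPdist_lt (FF := nbhs_filter x)) => eps e0; apply/nbhs_ballP; exists eps => // y.
rewrite -ball_normE /= => xy; apply: le_lt_trans xy.
by rewrite -[`|_|]/((Normc.normc _)%:C) -[leRHS]/((Normc.normc _)%:C) lecR.
Qed.

(** * Generators of the rotation algebra and their images *)

Section rotation_operators.
Variables (R : realType) (p : R) (p1 : 1 < p) (theta : R).
Local Notation E := (lp (ltW p1) (int * circle R)%type).
Local Notation Alg := (rotation_algebra (ltW p1) theta).
Implicit Types (xi : E) (n : int) (x : circle R).

Definition shift_index (k : int) (i : int * circle R) : int * circle R :=
  (i.1 - k, i.2).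

Lemma shift_index_bij k : bijective (shift_index k).
Proof.
by exists (shift_index (- k)) => -[n x]; rewrite /shift_index /= opprK ?subrK ?addrK.
Qed.

Definition lp_shift (k : int) : E -> E := lp_comp (shift_index_bij k).

(** The point of the rotation orbit of x at which a multiplication operator evaluates its function
    in coordinate (n, x). *)
Definition orbit_point (i : int * circle R) : R[i] :=
  expi (2 * pi * i.1%:~R * theta) * val i.2.

Lemma normc_orbit_point i : Normc.normc (orbit_point i) = 1.
Proof.
rewrite Normc.normcM normc_expi mul1r; case: i => n [x /= /eqP x1].
exact: (complexI x1).
Qed.

Section multiplication_operator.
Variables (f : R[i] -> R[i]).
Hypothesis f1 : forall z : R[i], Normc.normc z = 1 -> Normc.normc (f z) <= 1.

Let coef_le i : Normc.normc (f (orbit_point i)) <= 1.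
Proof. exact/f1/normc_orbit_point. Qed.

Definition lp_mulop : E -> E := lp_mul (p1 := ltW p1) coef_le.

Lemma lp_mulopE xi i : lp_mulop xi i = f (orbit_point i) * xi i.
Proof. by []. Qed.

Lemma lp_mulop_in : continuous_on_circle f -> Alg lp_mulop.
Proof. by move=> fC; apply: sub_gen_smallest; left; left; exists f. Qed.

Lemma opnorm_mulop : opnorm lp_mulop <= 1.
Proof.
apply: opnorm_le => // xi; rewrite mul1r; apply: rnorm_lp_sum_le.
apply: lp_sum_le => [|i]; first exact: ltW.
by rewrite lp_mulopE Normc.normcM -[leRHS]mul1r ler_wpM2r ?normc_ge0.
Qed.
End multiplication_operator.

Lemma lp_shift_in k : k = 1 \/ k = -1 -> Alg (lp_shift k).
Proof. by case=> ->; apply: sub_gen_smallest; [left; right | right]. Qed.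

Lemma opnorm_shift k : opnorm (lp_shift k) <= 1.
Proof. by apply: opnorm_le => // xi; rewrite mul1r rnorm_lp_comp. Qed.

Lemma lp_shiftK k xi : lp_shift k (lp_shift (- k) xi) = xi.
Proof.
apply: val_inj; apply/funext => -[n x] /=.
by rewrite /shift_index /= opprK subrK.
Qed.

Lemma rotation_linear (a : R[i]) S T : Alg S -> Alg T -> Alg (a *: S + T).
Proof.
by move=> AS AT M [MA GM]; apply: (csub_linear MA); [exact: AS | exact: AT].
Qed.

Lemma rotation_comp S T : Alg S -> Alg T -> Alg (S \o T).
Proof.
by move=> AS AT M [MA GM]; apply: (csub_comp MA); [exact: AS | exact: AT].
Qed.

Lemma rotation_id : Alg idfun.
Proof.
have -> : idfun = lp_shift 1 \o lp_shift (-1).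
  by apply/funext => xi; rewrite /= lp_shiftK.
by apply: rotation_comp; apply: lp_shift_in; [left | right].
Qed.

Lemma rotation_0 : Alg (0 : E -> E).
Proof.
have -> : (0 : E -> E) = -1 *: idfun + idfun.
  by apply/funext => xi; rewrite -[RHS]/(-1 *: xi + xi) scaleN1r addNr.
by apply: rotation_linear; exact: rotation_id.
Qed.

Section hermitian_image.
Variables (B : banachAlgType R[i]) (e : B) (phi : (E -> E) -> B).
Hypothesis hphi : unital_contractive_hom Alg e phi.

Lemma phi0 : phi 0 = 0.
Proof.
have := uchom_linear hphi (-1) rotation_id rotation_id.
have -> : -1 *: idfun + idfun = 0 :> (E -> E).
  by apply/funext => xi; rewrite -[LHS]/(-1 *: xi + xi) scaleN1r addNr.
by rewrite scaleN1r addNr.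
Qed.

Lemma phiZ (a : R[i]) S : Alg S -> phi (a *: S) = a *: phi S.
Proof.
move=> AS; rewrite -[X in phi X]addr0 (uchom_linear hphi a AS rotation_0).
by rewrite phi0 addr0.
Qed.

(** The coefficients of 1 + (z - 1) f are convex combinations (1 - t) + t z of two points of the
    circle, hence of modulus at most 1. *)
Lemma phi_hermitian f (f1 : forall z : R[i], Normc.normc z = 1 -> Normc.normc (f z) <= 1) :
  continuous_on_circle f ->
  (forall z, Normc.normc z = 1 -> exists2 t : R, 0 <= t <= 1 & f z = t%:C) ->
  near_hermitian e 0 (phi (lp_mulop f1)).
Proof.
move=> fC f01 z z1; have Af := lp_mulop_in f1 fC.
rewrite addr0 addrC -(uchom_unit hphi).
rewrite -(uchom_linear hphi (z - 1) Af rotation_id).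
apply: le_trans (uchom_contractive hphi (rotation_linear (z - 1) Af rotation_id)) _.
apply: opnorm_le => // xi; rewrite mul1r; apply: rnorm_lp_sum_le.
apply: lp_sum_le => [|i]; first exact: ltW.
rewrite -[X in Normc.normc X <= _]/((z - 1) * (f (orbit_point i) * xi i) + xi i).
have [t /andP[t0 t1] ->] := f01 _ (normc_orbit_point i).
have -> : (z - 1) * (t%:C * xi i) + xi i = (z * t%:C + (1 - t)%:C) * xi i.
  by rewrite rmorphB /=; ring.
rewrite Normc.normcM -[leRHS]mul1r ler_wpM2r ?normc_ge0 //.
apply: le_trans (le_normcD _ _) _.
rewrite Normc.normcM z1 !normc_real mul1r ger0_norm // ger0_norm ?subr_ge0 //.
by rewrite addrC subrK.
Qed.

End hermitian_image.

Lemma half_in01 (t : R) : `|t| <= 1 -> 0 <= (1 + t) / 2 <= 1.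
Proof. by rewrite ler_norml => /andP[h1 h2]; apply/andP; split; lra. Qed.

(** On the circle [fconj] is the inverse of the coordinate function [fid]. The functions [fre] and
    [fim] take values in [0, 1] there and satisfy z = (2 fre - 1) + i (2 fim - 1). *)
Let fid (z : R[i]) : R[i] := z.
Let fconj (z : R[i]) : R[i] := (z^*)%C.
Let fre (z : R[i]) : R[i] := ((1 + complex.Re z) / 2)%:C.
Let fim (z : R[i]) : R[i] := ((1 + complex.Im z) / 2)%:C.

Let fid1 z : Normc.normc z = 1 -> Normc.normc (fid z) <= 1.
Proof. by move=> ->. Qed.

Let fconj1 z : Normc.normc z = 1 -> Normc.normc (fconj z) <= 1.
Proof. by rewrite normc_conj => ->. Qed.

Let fre01 z : Normc.normc z = 1 -> exists2 t : R, 0 <= t <= 1 & fre z = t%:C.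
Proof.
by move=> z1; exists ((1 + complex.Re z) / 2) => //; rewrite half_in01 // -z1 Re_le_normc.
Qed.

Let fim01 z : Normc.normc z = 1 -> exists2 t : R, 0 <= t <= 1 & fim z = t%:C.
Proof.
by move=> z1; exists ((1 + complex.Im z) / 2) => //; rewrite half_in01 // -z1 Im_le_normc.
Qed.

Let fre1 z : Normc.normc z = 1 -> Normc.normc (fre z) <= 1.
Proof. by move=> /fre01[t /andP[t0 t1] ->]; rewrite normc_real ger0_norm. Qed.

Let fim1 z : Normc.normc z = 1 -> Normc.normc (fim z) <= 1.
Proof. by move=> /fim01[t /andP[t0 t1] ->]; rewrite normc_real ger0_norm. Qed.

Let fid_cont : continuous_on_circle fid.
Proof. exact: lipschitz_continuous_on_circle. Qed.

Let fconj_cont : continuous_on_circle fconj.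
Proof.
apply: lipschitz_continuous_on_circle => x y.
by rewrite /fconj -rmorphB normc_conj.
Qed.

Let half_le (s t r : R) : `|s - t| <= r -> `|(1 + s) / 2 - (1 + t) / 2| <= r.
Proof.
by rewrite !ler_norml => /andP[h1 h2]; apply/andP; split; lra.
Qed.

Let fre_cont : continuous_on_circle fre.
Proof.
apply: lipschitz_continuous_on_circle => x y.
rewrite /fre -rmorphB normc_real; apply: half_le.
have -> : complex.Re x - complex.Re y = complex.Re (x - y) by case: x y => ? ? [].
exact: Re_le_normc.
Qed.

Let fim_cont : continuous_on_circle fim.
Proof.
apply: lipschitz_continuous_on_circle => x y.
rewrite /fim -rmorphB normc_real; apply: half_le.
have -> : complex.Im x - complex.Im y = complex.Im (x - y) by case: x y => ? ? [].
exact: Im_le_normc.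
Qed.

Lemma rotation_hom_limit_torsion (B : banachAlgType R[i]) (e : B)
    (A : nat -> banachAlgType R[i]) (iota : forall j, A j -> A j.+1)
    (gamma : forall j, A j -> B) (phi : (E -> E) -> B) : p != 2 ->
  is_unit_element e -> (forall j, is_matrix_sum (ltW p1) (A j)) ->
  (forall j, algebra_hom (@iota j) /\ isometric (@iota j)) ->
  is_direct_limit iota gamma -> unital_contractive_hom Alg e phi ->
  exists2 N, (0 < N)%N & expi (2 * pi * theta) ^+ N = 1.
Proof.
move=> p2 he A_msum iota_hom Blim hphi.
have Au : Alg (lp_shift 1) by apply: lp_shift_in; left.
have Au' : Alg (lp_shift (-1)) by apply: lp_shift_in; right.
have Aw := lp_mulop_in fid1 fid_cont.
have Aw' := lp_mulop_in fconj1 fconj_cont.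
have A1 := lp_mulop_in fre1 fre_cont.
have A2 := lp_mulop_in fim1 fim_cont.
have contr T : Alg T -> opnorm T <= 1 -> rnorm (phi T) <= 1.
  by move=> AT; apply: le_trans; exact: (uchom_contractive hphi).
apply: (@limit_torsion R p p1 p2 B e he A iota gamma A_msum iota_hom Blim
  (phi (lp_shift 1)) (phi (lp_shift (-1))) (phi (lp_mulop fid1))
  (phi (lp_mulop fconj1)) (phi (lp_mulop fre1)) (phi (lp_mulop fim1))).
- by apply: contr => //; exact: opnorm_shift.
- by apply: contr => //; exact: opnorm_shift.
- by apply: contr => //; exact: opnorm_mulop.
- rewrite -(uchom_mul hphi) // -(uchom_unit hphi); congr phi.
  by apply/funext => xi; rewrite /= lp_shiftK.
- rewrite -(uchom_mul hphi) // -(uchom_unit hphi); congr phi.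
  by apply/funext => xi; exact: (lp_shiftK (-1) xi).
- rewrite -(uchom_mul hphi) // -(uchom_unit hphi); congr phi.
  apply/funext => xi; apply: val_inj; apply/funext => i.
  rewrite -[LHS]/(orbit_point i * ((orbit_point i)^*%C * xi i)) mulrA -sqr_normc.
  by rewrite -[`|_|]/((Normc.normc _)%:C) normc_orbit_point expr1n mul1r.
- exact: normc_expi.
(* In the other order of shift and coordinate function, the orbit point is taken at n - 1 instead of
   n; this accounts for the factor [expi (2 * pi * theta)]. *)
- rewrite -!(uchom_mul hphi) // -(phiZ hphi); last exact: rotation_comp.
  congr phi; apply/funext => xi; apply: val_inj; apply/funext => -[n x].
  rewrite -[LHS]/(orbit_point (n, x) * xi (n - 1, x)).
  rewrite -[RHS]/(expi (2 * pi * theta) * (orbit_point (n - 1, x) * xi (n - 1, x))).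
  rewrite !mulrA -expiD; congr (expi _ * _ * _).
  by rewrite /= intrD; ring.
- exact: phi_hermitian fre_cont fre01.
- exact: phi_hermitian fim_cont fim01.
(* This is 2 S - 1, in the form to which [uchom_linear] applies. *)
pose X S : E -> E := -1 *: idfun + (1 *: S + S).
have AX S : Alg S -> Alg (X S).
  move=> AS; apply: rotation_linear; first exact: rotation_id.
  exact: rotation_linear.
have phiX S : Alg S -> phi (X S) = 2%:R *: phi S - e.
  move=> AS; rewrite (uchom_linear hphi) //; first last.
  - exact: rotation_linear.
  - exact: rotation_id.
  rewrite (uchom_linear hphi) // (uchom_unit hphi) scale1r scaleN1r addrC.
  by rewrite scaler_nat mulr2n.
rewrite -!phiX // addrC -(uchom_linear hphi); [|exact: AX|exact: AX].
congr phi; apply/funext => xi; apply: val_inj; apply/funext => i.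
rewrite -[LHS]/(orbit_point i * xi i).
rewrite -[RHS]/('i * (-1 * xi i + (1 * (fim (orbit_point i) * xi i)
    + fim (orbit_point i) * xi i))
  + (-1 * xi i + (1 * (fre (orbit_point i) * xi i) + fre (orbit_point i) * xi i))).
rewrite {1}[orbit_point i]complexE complexiE /fim /fre.
have h (t : R) : t%:C = ((1 + t) / 2)%:C + ((1 + t) / 2)%:C - 1 :> R[i].
  by rewrite -rmorphD -splitr rmorphD addrAC subrr add0r.
rewrite (h (complex.Re _)) (h (complex.Im _)).
by ring.
Qed.

End rotation_operators.

Theorem corollary2 (R : realType) (p theta : R) (hp : 1 < p) (hp2 : p != 2)
    (htheta : irrational theta)
    (B : banachAlgType R[i]) (e : B) (he : is_unit_element e)
    (hB : spatial_AF_algebra (ltW hp) B) :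
  ~ exists phi,
      unital_contractive_hom (rotation_algebra (ltW hp) theta) e phi.
Proof.
move=> [phi hphi]; have [_ [A [iota [gamma [_ A_msum iota_hom Blim]]]]] := hB.
have [N N0] := rotation_hom_limit_torsion hp2 he A_msum iota_hom Blim hphi.
exact: expi_irrational.
Qed.
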